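(* Let $(\mathbf x,B)$ be a seed of $\mathcal F$. Then every cluster variable of $\mathcal A(\mathbf x,B)$ is an irreducible element of the integral domain $\mathcal A(\mathbf x,B)$ (i.e. it is non-invertible and cannot be written as a product of two non-invertible elements of $\mathcal A(\mathbf x,B)$).
   Context: Let $K$ be a field of characteristic $0$ or $K=\mathbb Z$. Fix integers $m\ge p\ge n\ge 1$ with $m>1$, and let $\mathcal F=K(X_1,\dots,X_m)$. For $B=(b_{ij})\in M_{m,n}(\mathbb Z)$ the principal part $B^\circ$ is the $n\times n$ matrix formed by the first $n$ rows. $B$ is connected if the graph with vertices $1,\dots,m$ and an edge between $i$ and $j$ whenever $b_{ij}\neq 0$ or $b_{ji}\ne 0$ is connected. A square integer matrix $A$ is skew-symmetrizable if $DA$ is skew-symmetric for some diagonal integer matrix $D$ with positive diagonal entries. A seed of $\mathcal F$ is a pair $(\mathbf x,B)$ where $B\in M_{m,n}(\mathbb Z)$ is connected with $B^\circ$ skew-symmetrizable, and $\mathbf x=(x_1,\dots,x_m)$ is an $m$-tuple of elements of $\mathcal F$ algebraically independent over $K$. For $1\le k\le n$ the mutation $\mu_k(\mathbf x,B)=(\mathbf x',B')$ is given by $b'_{ij}=-b_{ij}$ if $i=k$ or $j=k$, and $b'_{ij}=b_{ij}+\frac{|b_{ik}|b_{kj}+b_{ik}|b_{kj}|}{2}$ otherwise; $x'_s=x_s$ for $s\neq k$ and $x'_k=x_k^{-1}\big(\prod_{b_{ik}>0}x_i^{b_{ik}}+\prod_{b_{ik}<0}x_i^{-b_{ik}}\big)$.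 Two seeds are mutation equivalent if one is obtained from the other by a finite sequence of mutations $\mu_{i_1},\dots,\mu_{i_t}$ with $1\le i_j\le n$. The cluster algebra $\mathcal A(\mathbf x,B)$ is the $K$-subalgebra of $\mathcal F$ generated by $x_{n+1}^{\pm1},\dots,x_p^{\pm1},x_{p+1},\dots,x_m$ together with all elements $y_1,\dots,y_n$ for all seeds $(\mathbf y,C)$ mutation equivalent to $(\mathbf x,B)$; these $y_i$ ($1\le i\le n$) are the cluster variables. *)

(* Defs.v *)
From HB Require Import structures.
From mathcomp Require Import all_boot all_order all_algebra.
From mathcomp Require Import fraction.
From mathcomp Require Import mpoly.
Set Implicit Arguments. Unset Strict Implicit. Unset Printing Implicit Defensive.
Import Order.TTheory GRing.Theory Num.Theory.
Local Open Scope ring_scope.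

Definition ratfun (K : idomainType) (m : nat) := {fraction {mpoly K[m]}}.

Definition Kconst (K : idomainType) (m : nat) (c : K) : ratfun K m :=
  @FracField.tofrac _ (mpolyC m c).

Definition alg_indep (K : idomainType) (m : nat) (x : 'I_m -> ratfun K m) :=
  forall p : {mpoly K[m]}, mmap (@Kconst K m) x p = 0 -> p = 0.

Section Seeds.
Variables (m n : nat) (nm : (n <= m)%N).

(* column index k : 'I_n viewed as a row index in 'I_m *)
Definition rw (k : 'I_n) : 'I_m := widen_ord nm k.

Definition bgraph (B : 'M[int]_(m, n)) : rel 'I_m :=
  fun i j =>
    [exists k : 'I_n, (rw k == j) && (B i k != 0)] ||
    [exists k : 'I_n, (rw k == i) && (B j k != 0)].

Definition connected_mx (B : 'M[int]_(m, n)) : Prop :=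
  forall i j : 'I_m, connect (bgraph B) i j.

Definition principal (B : 'M[int]_(m, n)) : 'M[int]_n :=
  \matrix_(i < n, j < n) B (rw i) j.

Definition skew_symmetrizable (n' : nat) (A : 'M[int]_n') : Prop :=
  exists d : 'I_n' -> int, (forall i, 0 < d i) /\
    (forall i j, d i * A i j = - (d j * A j i)).

Definition is_seed (K : idomainType) (x : 'I_m -> ratfun K m)
    (B : 'M[int]_(m, n)) : Prop :=
  alg_indep x /\ connected_mx B /\ skew_symmetrizable (principal B).

Definition mut_mx (k : 'I_n) (B : 'M[int]_(m, n)) : 'M[int]_(m, n) :=
  \matrix_(i < m, j < n)
    if (i == rw k) || (j == k) then - B i j
    else B i j + ((`|B i k|%:Z * B (rw k) j + B i k * `|B (rw k) j|%:Z) %/ 2)%Z.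

Definition mut_x (K : idomainType) (k : 'I_n) (x : 'I_m -> ratfun K m)
    (B : 'M[int]_(m, n)) : 'I_m -> ratfun K m :=
  fun s => if s == rw k then
     (x s)^-1 * (\prod_(i < m | 0 < B i k) x i ^+ `|B i k|%N
                 + \prod_(i < m | B i k < 0) x i ^+ `|B i k|%N)
   else x s.

Definition mutate (K : idomainType) (k : 'I_n)
    (S : ('I_m -> ratfun K m) * 'M[int]_(m, n)) :=
  (mut_x k S.1 S.2, mut_mx k S.2).

Definition mutseq (K : idomainType) (s : seq 'I_n)
    (S : ('I_m -> ratfun K m) * 'M[int]_(m, n)) :=
  foldl (fun S k => mutate k S) S s.

Definition cluster_variable (K : idomainType) (x : 'I_m -> ratfun K m)
    (B : 'M[int]_(m, n)) (z : ratfun K m) : Prop :=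
  exists (s : seq 'I_n) (i : 'I_n), z = (mutseq s (x, B)).1 (rw i).

Definition cluster_gen (K : idomainType) (p : nat) (x : 'I_m -> ratfun K m)
    (B : 'M[int]_(m, n)) (z : ratfun K m) : Prop :=
  (exists j : 'I_m, [/\ (n <= j)%N, (j < p)%N & (z = x j \/ z = (x j)^-1)])
  \/ (exists j : 'I_m, (p <= j)%N /\ z = x j)
  \/ cluster_variable x B z.

End Seeds.

Inductive in_gen_alg (K : idomainType) (m : nat) (G : ratfun K m -> Prop)
  : ratfun K m -> Prop :=
| ga_const c : in_gen_alg G (Kconst m c)
| ga_gen z : G z -> in_gen_alg G z
| ga_add a b : in_gen_alg G a -> in_gen_alg G b -> in_gen_alg G (a + b)
| ga_opp a : in_gen_alg G a -> in_gen_alg G (- a)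
| ga_mul a b : in_gen_alg G a -> in_gen_alg G b -> in_gen_alg G (a * b).

Definition in_cluster_alg (K : idomainType) (m n p : nat) (nm : (n <= m)%N)
    (x : 'I_m -> ratfun K m) (B : 'M[int]_(m, n)) : ratfun K m -> Prop :=
  in_gen_alg (cluster_gen nm p x B).

Definition unit_in (K : idomainType) (m : nat) (A : ratfun K m -> Prop)
    (a : ratfun K m) : Prop :=
  A a /\ exists b, A b /\ a * b = 1.

Definition irreducible_in (K : idomainType) (m : nat) (A : ratfun K m -> Prop)
    (z : ratfun K m) : Prop :=
  [/\ A z, ~ unit_in A z &
      forall a b, A a -> A b -> z = a * b -> unit_in A a \/ unit_in A b].

(* Main.v *)
Require Import Defs.
From HB Require Import structures.
From mathcomp Require Import all_boot all_order all_algebra.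
From mathcomp Require Import fraction.
From mathcomp Require Import mpoly.
From mathcomp Require Import zify ring.
From Stdlib Require Import FunctionalExtensionality.
Set Implicit Arguments. Unset Strict Implicit. Unset Printing Implicit Defensive.
Import Order.TTheory GRing.Theory Num.Theory.
Local Open Scope ring_scope.

(** Laurent phenomenon, by induction on the length of a mutation path j, k, ...
   starting at a seed t0: adjoin one frozen variable Y, attached to the column k,
   and let t1 = mu_j t0, t3 = mu_j mu_k t1. An element f reached by the path is a
   Laurent polynomial in t1 and in t3 by induction. Over D[Y, 1/Y], with D the ring
   of Laurent polynomials of t0, the new variable of t1 is a constant, while those
   of t3 are polynomials in Y whose constant terms are units of D; hence f lies in
   D[Y, 1/Y], and one puts Y = 1.

   Irreducibility: every cluster variable may be taken to be a variable x_k of the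
   initial seed. If x_k = a b in the cluster algebra, then a and b are Laurent
   polynomials with monomial product, so they are monomials up to units of K. Their
   exponents at a mutable index are nonnegative, because a and b are also Laurent
   in the seed mutated there, where x_s is a genuine binomial over a variable; the
   exponents at a non-invertible frozen index j are nonnegative because all elements
   of the cluster algebra are regular at the point x_j = 0, x_i = 1 (i <> j), where
   the other cluster variables take positive rational values. So one of a and b
   involves only invertible frozen variables. *)


(** * Values of field elements at a point where they are regular *)

Section Specialization.
Variables (R : comNzRingType) (F E : fieldType).
Variables (alpha : {rmorphism R -> F}) (beta : {rmorphism R -> E}).
Hypothesis alpha_inj : injective alpha.

(** For injective [alpha] this is the graph of the map to [E] from the localization of [R] at the
    kernel of [beta], seen inside [F]. A relation is used because only the elements of [F] with a
    suitable denominator have a value. *)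
Definition spec (f : F) (v : E) : Prop :=
  exists a d, [/\ beta d != 0, f * alpha d = alpha a & v * beta d = beta a].

Lemma spec_rmorph a : spec (alpha a) (beta a).
Proof. by exists a, 1; rewrite !rmorph1 !mulr1 oner_neq0. Qed.

Lemma spec0 : spec 0 0.
Proof. by have := spec_rmorph 0; rewrite !rmorph0. Qed.

Lemma spec1 : spec 1 1.
Proof. by have := spec_rmorph 1; rewrite !rmorph1. Qed.

Lemma specD f g v w : spec f v -> spec g w -> spec (f + g) (v + w).
Proof.
move=> [a [d [d0 fE vE]]] [a' [d' [d0' gE wE]]].
exists (a * d' + a' * d), (d * d'); split; first by rewrite rmorphM mulf_neq0.
  by rewrite rmorphD !rmorphM -fE -gE; ring.
by rewrite rmorphD !rmorphM -vE -wE; ring.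
Qed.

Lemma specN f v : spec f v -> spec (- f) (- v).
Proof.
move=> [a [d [d0 fE vE]]]; exists (- a), d.
by split; rewrite ?rmorphN ?mulNr ?fE ?vE.
Qed.

Lemma specM f g v w : spec f v -> spec g w -> spec (f * g) (v * w).
Proof.
move=> [a [d [d0 fE vE]]] [a' [d' [d0' gE wE]]].
exists (a * a'), (d * d'); split; first by rewrite rmorphM mulf_neq0.
  by rewrite !rmorphM -fE -gE; ring.
by rewrite !rmorphM -vE -wE; ring.
Qed.

Lemma specX f v n : spec f v -> spec (f ^+ n) (v ^+ n).
Proof.
move=> fv; elim: n => [|n IHn]; first by rewrite !expr0; exact: spec1.
by rewrite !exprS; exact: specM.
Qed.

Lemma spec_prod (I : Type) (l : seq I) (P : pred I) (f : I -> F) (v : I -> E) :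
  (forall i, P i -> spec (f i) (v i)) ->
  spec (\prod_(i <- l | P i) f i) (\prod_(i <- l | P i) v i).
Proof.
move=> fv; elim/big_rec2: _ => [|i w g Pi gw]; first exact: spec1.
exact: specM (fv i Pi) gw.
Qed.

Lemma specV f v : v != 0 -> spec f v -> spec f^-1 v^-1.
Proof.
move=> v0 [a [d [d0 fE vE]]].
have bd0 : beta a != 0 by rewrite -vE mulf_neq0.
have neq0 e : beta e != 0 -> alpha e != 0.
  by apply: contraNneq => e0; rewrite (alpha_inj (etrans e0 (esym (rmorph0 _)))) rmorph0.
exists d, a; split=> //; last by rewrite -vE mulKf.
by rewrite -fE mulKf //; move: (neq0 _ bd0); rewrite -fE mulf_eq0 negb_or => /andP[].
Qed.

Lemma spec_inj f v w : spec f v -> spec f w -> v = w.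
Proof.
move=> [a [d [d0 fE vE]]] [a' [d' [d0' gE wE]]].
have: alpha (a * d') = alpha (a' * d).
  by rewrite !rmorphM -fE -gE; ring.
move/alpha_inj/(congr1 beta); rewrite !rmorphM -vE -wE => e.
apply: (mulIf (mulf_neq0 d0 d0')).
by rewrite mulrA e; ring.
Qed.

End Specialization.

(** * Seed mutation over arbitrary finite index types *)

Section Mutation.
Variables (I J : finType) (r : J -> I).

Definition pospart (z : int) : nat := if z is Posz n then n else 0%N.

Lemma pospartE z : Posz (pospart z) = if 0 <= z then z else 0.
Proof. by case: z. Qed.

Lemma pospartN z : Posz (pospart (- z)) = if 0 <= z then 0 else - z.
Proof. by rewrite pospartE; case: ifP; case: ifP; lia. Qed.

(** Products of positive parts replace the halved sum of absolute values, so no division occurs;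
    [half_mut_entry] compares the two. Arbitrary row types make it possible to adjoin a row by
    passing to [option I]. *)
Definition gmut_mx k (b : I -> J -> int) : I -> J -> int := fun i j =>
  if (i == r k) || (j == k) then - b i j
  else b i j + Posz (pospart (b i k) * pospart (b (r k) j))
       - Posz (pospart (- b i k) * pospart (- b (r k) j)).

Definition exchange (F : comNzRingType) (x : I -> F) (c : I -> int) : F :=
  \prod_i x i ^+ pospart (c i) + \prod_i x i ^+ pospart (- c i).

Definition gmut_x (F : fieldType) k (x : I -> F) (b : I -> J -> int) : I -> F :=
  fun i => if i == r k then exchange x (b^~ k) / x i else x i.

Definition gmut (F : fieldType) k (S : (I -> F) * (I -> J -> int)) :=
  (gmut_x k S.1 S.2, gmut_mx k S.2).

Definition gmutseq (F : fieldType) (s : seq J) (S : (I -> F) * (I -> J -> int)) :=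
  foldl (fun S k => gmut k S) S s.

Definition skewable (b : I -> J -> int) : Prop :=
  exists d : J -> int, (forall j, 0 < d j) /\
    (forall i j, d i * b (r i) j = - (d j * b (r j) i)).

Lemma exchangeN (F : comNzRingType) (x : I -> F) c :
  exchange x (fun i => - c i) = exchange x c.
Proof.
rewrite /exchange addrC; congr (_ + _).
by apply: eq_bigr => i _; rewrite opprK.
Qed.

Lemma eq_exchange (F : comNzRingType) (x y : I -> F) c :
  (forall i, c i != 0 -> x i = y i) -> exchange x c = exchange y c.
Proof.
move=> xy; congr (_ + _); apply: eq_bigr => i _;
by have [->|/xy ->] := eqVneq (c i) 0; rewrite ?oppr0 ?expr0.
Qed.

Lemma gmut_mxN k b : gmut_mx k (fun i j => - b i j) = (fun i j => - gmut_mx k b i j).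
Proof.
apply: functional_extensionality => i; apply: functional_extensionality => j.
rewrite /gmut_mx; case: ifP => // _; rewrite !opprK; lia.
Qed.

Lemma gmutN (F : fieldType) k (x : I -> F) b :
  gmut k (x, fun i j => - b i j) =
  ((gmut k (x, b)).1, fun i j => - (gmut k (x, b)).2 i j).
Proof.
rewrite /gmut /= gmut_mxN; congr (_, _); apply: functional_extensionality => i.
by rewrite /gmut_x exchangeN.
Qed.

Lemma gmutseqN (F : fieldType) s (x : I -> F) b :
  gmutseq s (x, fun i j => - b i j) =
  ((gmutseq s (x, b)).1, fun i j => - (gmutseq s (x, b)).2 i j).
Proof.
rewrite /gmutseq; elim: s x b => [|k s IHs] x b //=.
by rewrite gmutN IHs -surjective_pairing.
Qed.

Lemma gmut_mx_skewable k b : injective r -> skewable b -> skewable (gmut_mx k b).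
Proof.
move=> r_inj [d [d0 db]]; exists d; split=> // i j; rewrite /gmut_mx !inj_eq //.
have [->|ik] := eqVneq i k; first by rewrite orbT /= !mulrN db.
have [->|jk] := eqVneq j k; first by rewrite /= !mulrN db.
rewrite /=.
(* The old symmetrizer still works: it carries the positive part of an entry to the negative part of
   the transposed entry. *)
have pp u v a c : 0 < u -> 0 < v -> u * a = - (v * c) ->
    u * Posz (pospart a) = v * Posz (pospart (- c)).
  move=> u0 v0 e; rewrite pospartE pospartN.
  case: ifP => a0; case: ifP => c0; nia.
have e1 := pp _ _ _ _ (d0 i) (d0 k) (db i k).
have e2 := pp _ _ _ _ (d0 k) (d0 j) (db k j).
have e3 := pp _ _ _ _ (d0 j) (d0 k) (db j k).
have e4 := pp _ _ _ _ (d0 k) (d0 i) (db k i).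
have prodE u1 u2 u3 a1 a2 a3 a4 : u1 * a1 = u2 * a2 -> u2 * a3 = u3 * a4 ->
    u1 * (a1 * a3) = u3 * (a4 * a2) :> int.
  by move=> h1 h2; rewrite mulrA h1 mulrAC h2; ring.
have E1 := prodE _ _ _ _ _ _ _ e1 e2.
have E2 := prodE _ _ _ _ _ _ _ e3 e4.
rewrite !PoszM !mulrBr !mulrDr (db i j) E1 E2; ring.
Qed.

Lemma skew_diag b k : skewable b -> b (r k) k = 0.
Proof. by move=> [d [d0 db]]; have := db k k; have := d0 k; nia. Qed.

Lemma skew_gt0 b j k : skewable b -> (0 < b (r k) j) = (b (r j) k < 0).
Proof. by move=> [d [d0 db]]; have := db j k; have := d0 j; have := d0 k; nia. Qed.

Lemma gmut_mxK k b : injective r -> b (r k) k = 0 -> gmut_mx k (gmut_mx k b) = b.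
Proof.
move=> r_inj bkk.
apply: functional_extensionality => i; apply: functional_extensionality => j.
rewrite /gmut_mx !eqxx !orbT /=.
have [->|ik] := eqVneq i (r k); first by rewrite /= opprK.
have [->|jk] := eqVneq j k; first by rewrite /= opprK.
by rewrite /= !opprK; lia.
Qed.

(** The first mutation only negates column [k], and the zero entry keeps the changed variable out of
    the exchange sum, so both mutations use the same sum. *)
Lemma gmut_xK (F : fieldType) k (x : I -> F) b : b (r k) k = 0 ->
  x (r k) != 0 -> exchange x (b^~ k) != 0 ->
  gmut_x k (gmut_x k x b) (gmut_mx k b) = x.
Proof.
move=> bkk xk ek; apply: functional_extensionality => i; rewrite /gmut_x.
have [->|//] := eqVneq i (r k); rewrite -(exchangeN _ (b^~ k)) in ek *.
rewrite [exchange _ _](_ : _ = exchange x (fun i => - b i k)).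
  by rewrite invfM invrK mulrA divff // mul1r.
have bE i0 : gmut_mx k b i0 k = - b i0 k by rewrite /gmut_mx eqxx orbT.
rewrite /exchange; under eq_bigr do rewrite bE.
under [X in _ + X]eq_bigr do rewrite bE.
apply: eq_exchange => i0; have [->|//] := eqVneq i0 (r k).
by rewrite bkk oppr0 eqxx.
Qed.

(** This is the consequence of connectedness that enters the proof: it survives mutation and makes
    every exchange sum a genuine binomial. *)
Definition col_nz (b : I -> J -> int) := forall j, exists i, b i j != 0.

Lemma gmut_mx_col_nz k b : col_nz b -> col_nz (gmut_mx k b).
Proof.
move=> bnz j; have [i bij] := bnz j.
have [->|jk] := eqVneq j k.
  by have [i' b'] := bnz k; exists i'; rewrite /gmut_mx eqxx orbT oppr_eq0.
have [bkj|bkj] := eqVneq (b (r k) j) 0; last first.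
  by exists (r k); rewrite /gmut_mx eqxx oppr_eq0.
exists i; rewrite /gmut_mx (negPf jk) orbF; case: ifP => _; first by rewrite oppr_eq0.
by rewrite bkj oppr0 !muln0 subr0 addr0.
Qed.

End Mutation.

(** * Generated subrings and polynomials with coefficients in them *)

Inductive gen_ring (F : nzRingType) (G : F -> Prop) : F -> Prop :=
| gr_one : gen_ring G 1
| gr_gen f : G f -> gen_ring G f
| gr_sub f g : gen_ring G f -> gen_ring G g -> gen_ring G (f - g)
| gr_mul f g : gen_ring G f -> gen_ring G g -> gen_ring G (f * g).

Section GenRing.
Variables (F : nzRingType) (G : F -> Prop).

Lemma gr0 : gen_ring G 0.
Proof. by rewrite -(subrr 1); apply: gr_sub; exact: gr_one. Qed.

Lemma gr_add f g : gen_ring G f -> gen_ring G g -> gen_ring G (f + g).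
Proof.
move=> hf hg; rewrite -[g]opprK; apply: gr_sub => //.
by rewrite -sub0r; apply: gr_sub => //; exact: gr0.
Qed.

Lemma gr_exp f n : gen_ring G f -> gen_ring G (f ^+ n).
Proof.
move=> hf; elim: n => [|n IHn]; first exact: gr_one.
by rewrite exprS; exact: gr_mul.
Qed.

Lemma gr_sum (T : Type) (l : seq T) (P : pred T) (f : T -> F) :
  (forall i, P i -> gen_ring G (f i)) -> gen_ring G (\sum_(i <- l | P i) f i).
Proof.
move=> hf; elim/big_rec: _ => [|i g Pi hg]; first exact: gr0.
exact: gr_add (hf i Pi) hg.
Qed.

Definition poly_over (p : {poly F}) := forall i, gen_ring G p`_i.

Lemma poly_overC c : gen_ring G c -> poly_over c%:P.
Proof. by move=> hc i; rewrite coefC; case: ifP => _ //; exact: gr0. Qed.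

Lemma poly_overX : poly_over 'X.
Proof. by move=> i; rewrite coefX; case: (_ == _); [exact: gr_one | exact: gr0]. Qed.

Lemma poly_over_sub p q : poly_over p -> poly_over q -> poly_over (p - q).
Proof. by move=> hp hq i; rewrite coefB; exact: gr_sub. Qed.

Lemma poly_over_add p q : poly_over p -> poly_over q -> poly_over (p + q).
Proof. by move=> hp hq i; rewrite coefD; exact: gr_add. Qed.

Lemma poly_over_mul p q : poly_over p -> poly_over q -> poly_over (p * q).
Proof.
by move=> hp hq i; rewrite coefM; apply: gr_sum => j _; exact: gr_mul.
Qed.

Lemma poly_over_exp p n : poly_over p -> poly_over (p ^+ n).
Proof.
move=> hp; elim: n => [|n IHn]; first by apply: poly_overC; exact: gr_one.
by rewrite exprS; exact: poly_over_mul.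
Qed.

Lemma poly_over_eval1 p : poly_over p -> gen_ring G p.[1].
Proof.
move=> hp; rewrite horner_coef; apply: gr_sum => i _.
by rewrite expr1n mulr1.
Qed.

End GenRing.

(** * Laurent polynomials in a family of field elements, and their units *)

Section Laurent.
Variables (F : fieldType) (I : finType) (x : I -> F).

Definition laurent := gen_ring (fun f => exists i, f = x i \/ f = (x i)^-1).

(** The condition [f != 0] has to be stated, since the inverse of 0 is 0. *)
Definition lunit f := [/\ f != 0, laurent f & laurent f^-1].

Lemma laurent_var i : laurent (x i).
Proof. by apply: gr_gen; exists i; left. Qed.

Lemma laurent_varV i : laurent (x i)^-1.
Proof. by apply: gr_gen; exists i; right. Qed.

Lemma lunit_var i : x i != 0 -> lunit (x i).
Proof. by split=> //; [exact: laurent_var | exact: laurent_varV]. Qed.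

Lemma lunitM f g : lunit f -> lunit g -> lunit (f * g).
Proof.
move=> [f0 f1 f2] [g0 g1 g2]; split; [by rewrite mulf_neq0 | exact: gr_mul |].
by rewrite invfM; exact: gr_mul.
Qed.

Lemma lunitV f : lunit f -> lunit f^-1.
Proof. by move=> [f0 f1 f2]; split; rewrite ?invr_eq0 ?invrK. Qed.

Lemma lunit1 : lunit 1.
Proof. by split; rewrite ?oner_neq0 ?invr1 //; exact: gr_one. Qed.

Lemma lunitX f n : lunit f -> lunit (f ^+ n).
Proof.
move=> hf; elim: n => [|n IHn]; first exact: lunit1.
by rewrite exprS; exact: lunitM.
Qed.

Lemma lunit_prod (T : Type) (l : seq T) (P : pred T) (f : T -> F) :
  (forall i, P i -> lunit (f i)) -> lunit (\prod_(i <- l | P i) f i).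
Proof.
move=> hf; elim/big_rec: _ => [|i g Pi hg]; first exact: lunit1.
exact: lunitM (hf i Pi) hg.
Qed.

End Laurent.

(** * Laurent polynomials in one variable over a generated subring *)

Section OneVariable.
Variables (F : fieldType) (G : F -> Prop).
Notation F' := {fraction {poly F}}.
Notation tof := (@FracField.tofrac {poly F}).
Notation D := (gen_ring G).

(** The ring D[X, 1/X] as a subset of the fraction field of F[X]. *)
Definition lpoly_over (f : F') :=
  exists N (p : {poly F}), poly_over G p /\ f * tof ('X ^+ N) = tof p.

Lemma tof_X_neq0 N : tof ('X ^+ N) != 0.
Proof. by rewrite tofrac_eq0 expf_neq0 // polyX_eq0. Qed.

Lemma lpoly_over_poly p : poly_over G p -> lpoly_over (tof p).
Proof. by exists 0%N, p; rewrite expr0 tofrac1 mulr1. Qed.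

Lemma lpoly_over1 : lpoly_over 1.
Proof. by rewrite -tofrac1; apply: lpoly_over_poly; apply: poly_overC; exact: gr_one. Qed.

Lemma lpoly_over_sub f g : lpoly_over f -> lpoly_over g -> lpoly_over (f - g).
Proof.
move=> [N [p [hp fE]]] [M [q [hq gE]]]; exists (N + M)%N, (p * 'X^M - q * 'X^N).
split; last first.
  by rewrite exprD tofracB !tofracM -fE -gE; ring.
by apply: poly_over_sub; apply: poly_over_mul => //; apply: poly_over_exp; exact: poly_overX.
Qed.

Lemma lpoly_over_mul f g : lpoly_over f -> lpoly_over g -> lpoly_over (f * g).
Proof.
move=> [N [p [hp fE]]] [M [q [hq gE]]]; exists (N + M)%N, (p * q).
split; first exact: poly_over_mul.
by rewrite exprD !tofracM -fE -gE; ring.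
Qed.

Lemma lpoly_over_exp f n : lpoly_over f -> lpoly_over (f ^+ n).
Proof.
move=> hf; elim: n => [|n IHn]; first exact: lpoly_over1.
by rewrite exprS; exact: lpoly_over_mul.
Qed.

Lemma lpoly_over_XV : lpoly_over (tof 'X)^-1.
Proof.
exists 1%N, 1; split; first by apply: poly_overC; exact: gr_one.
by rewrite expr1 mulVf ?tofrac1 // -[X in tof X]expr1 tof_X_neq0.
Qed.

(** Only finitely many generators enter [f], so a single power of [q] clears all their
    denominators. *)
Lemma gen_ring_clear_denom (G' : F' -> Prop) q f : lpoly_over q ->
  (forall g, G' g -> exists a, lpoly_over (g * q ^+ a)) ->
  gen_ring G' f -> exists a, lpoly_over (f * q ^+ a).
Proof.
move=> hq hG; elim=> [|g|g h _ [a ha] _ [b hb]|g h _ [a ha] _ [b hb]].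
- by exists 0%N; rewrite expr0 mulr1; exact: lpoly_over1.
- exact: hG.
- exists (a + b)%N.
  rewrite (_ : _ * _ = g * q ^+ a * q ^+ b - h * q ^+ b * q ^+ a); last by rewrite exprD; ring.
  by apply: lpoly_over_sub; apply: lpoly_over_mul => //; exact: lpoly_over_exp.
- exists (a + b)%N.
  rewrite (_ : _ * _ = g * q ^+ a * (h * q ^+ b)); last by rewrite exprD; ring.
  exact: lpoly_over_mul.
Qed.

(** As for power series: coefficient i of [p * q] is coefficient i of [p] times the constant term of
    [q], plus a sum involving only lower coefficients of [p]. *)
Lemma poly_over_div (p q : {poly F}) : poly_over G q -> q`_0 != 0 -> D (q`_0)^-1 ->
  poly_over G (p * q) -> poly_over G p.
Proof.
move=> hq q0 q0V hpq; elim/ltn_ind => i IHi.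
have := hpq i; rewrite coefMr big_ord_recl /= subn0.
set S := \sum_(_ < _) _ => h.
have -> : p`_i = (p`_i * q`_0 + S - S) * (q`_0)^-1 by rewrite addrK mulfK.
apply: gr_mul => //; apply: gr_sub => //; apply: gr_sum => j _.
by apply: gr_mul => //; apply: IHi; have := ltn_ord j; rewrite /= /bump /=; lia.
Qed.

(* Clearing the constant z makes f a Laurent polynomial over F; its coefficients
   are then recovered in D from the lowest one upwards, because q has an
   invertible constant term. *)
Lemma lpoly_over_div (f : F') (z : F) (q : {poly F}) a b :
  z != 0 -> poly_over G q -> q`_0 != 0 -> D (q`_0)^-1 ->
  lpoly_over (f * tof z%:P ^+ a) -> lpoly_over (f * tof q ^+ b) -> lpoly_over f.
Proof.
move=> z0 hq q0 q0V [N [p1 [_ e1]]] [M [p2 [hp2 e2]]].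
pose p := (z ^- a)%:P * p1; exists N, p.
have fE : f * tof ('X ^+ N) = tof p.
  rewrite /p tofracM -e1 -tofracXn -rmorphXn /=.
  rewrite (_ : _ * (_ * _) = (tof (z ^- a)%:P * tof (z ^+ a)%:P) * (f * tof 'X^N)); last by ring.
  by rewrite -tofracM -polyCM mulVf ?expf_neq0 // tofrac1 mul1r.
split=> //; clearbody p.
have coef0X n : (q ^+ n)`_0 = q`_0 ^+ n.
  by rewrite -!horner_coef0 horner_exp.
have h : poly_over G (p * 'X^M * q ^+ b).
  rewrite (_ : _ * _ = p2 * 'X^N).
    by apply: poly_over_mul => //; apply: poly_over_exp; exact: poly_overX.
  by apply/eqP; rewrite -tofrac_eq !tofracM -fE -e2 -tofracXn; apply/eqP; ring.
have h' : poly_over G (p * 'X^M).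
  apply: (poly_over_div (q := q ^+ b)) => //; first exact: poly_over_exp.
    by rewrite coef0X expf_neq0.
  by rewrite coef0X -exprVn; exact: gr_exp.
by move=> i; have := h' (i + M)%N; rewrite coefMXn addnK ltnNge leq_addl.
Qed.

End OneVariable.

Lemma prod_option (R : comNzRingType) (I : finType) (f : option I -> R) :
  \prod_i f i = f None * \prod_i f (Some i).
Proof.
rewrite (bigD1 None) //=; congr (_ * _).
rewrite (reindex_omap Some id) //=; last by case.
by apply: eq_bigl => i; rewrite eqxx.
Qed.

(** * Adjoining one frozen variable to a seed *)

Section ExtraRow.
Variables (I J : finType) (r : J -> I).

Lemma gmut_mx_Some k (b' : option I -> J -> int) (b : I -> J -> int) :
  (forall i j, b' (Some i) j = b i j) ->
  forall i j, gmut_mx (Some \o r) k b' (Some i) j = gmut_mx r k b i j.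
Proof. by move=> bE i j; rewrite /gmut_mx /= !bE. Qed.

Lemma exchange_option (R : comNzRingType) (x : option I -> R) c :
  exchange x c = x None ^+ pospart (c None) * \prod_i x (Some i) ^+ pospart (c (Some i))
    + x None ^+ pospart (- c None) * \prod_i x (Some i) ^+ pospart (- c (Some i)).
Proof. by rewrite /exchange !prod_option. Qed.

(** The zero entry of the extra row keeps the adjoined variable out of the exchange relation at
    [k]. *)
Lemma gmut_x_Some (F F' : fieldType) (h : {rmorphism F -> F'}) k x' b' x b :
  (forall i, x' (Some i) = h (x i)) -> (forall i j, b' (Some i) j = b i j) ->
  b' None k = 0 ->
  forall i, gmut_x (Some \o r) k x' b' (Some i) = h (gmut_x r k x b i).
Proof.
move=> xE bE b0 i; rewrite /gmut_x /= xE; case: ifP => [/eqP[->]|/eqP ne]; last first.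
  by case: eqP ne => [->|].
rewrite eqxx fmorph_div; congr (_ / _).
rewrite exchange_option b0 oppr0 expr0 !mul1r rmorphD !rmorph_prod.
by congr (_ + _); apply: eq_bigr => i0 _; rewrite rmorphXn xE bE.
Qed.

(** A frozen variable with value 1 contributes a factor 1 to every exchange monomial, and the
    nonvanishing of the old variables permits each division. *)
Lemma spec_gmutseq_option (R : comNzRingType) (F E : fieldType)
  (alpha : {rmorphism R -> F}) (beta : {rmorphism R -> E}) s x' b' x b :
  injective alpha ->
  (forall i, spec alpha beta (x' (Some i)) (x i)) -> spec alpha beta (x' None) 1 ->
  (forall i j, b' (Some i) j = b i j) ->
  (forall t i, (gmutseq r t (x, b)).1 i != 0) ->
  let S' := gmutseq (Some \o r) s (x', b') in
  (forall i, spec alpha beta (S'.1 (Some i)) ((gmutseq r s (x, b)).1 i)) /\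
  spec alpha beta (S'.1 None) 1.
Proof.
move=> ainj; elim: s x' b' x b => [|k s IHs] x' b' x b xE x1 bE nz //=.
apply: IHs => //=; last by move=> t; exact: (nz (k :: t)).
- move=> i; rewrite /gmut_x /=.
  have [->|ne] := eqVneq i (r k); last first.
    by rewrite (_ : (Some i == Some (r k)) = false) //; apply/eqP => -[]; move/eqP: ne.
  rewrite eqxx; apply: specM; last by apply: specV => //; exact: (nz [::]).
  rewrite exchange_option -[exchange x _]/(_ + _) /=.
  apply: specD; rewrite -[X in spec _ _ _ X]mul1r; apply: specM.
  + by rewrite -[X in spec _ _ _ X](expr1n _ (pospart (b' None k))); exact: specX.
  + by apply: spec_prod => i0 _; rewrite bE; exact: specX.
  + by rewrite -[X in spec _ _ _ X](expr1n _ (pospart (- b' None k))); exact: specX.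
  + by apply: spec_prod => i0 _; rewrite bE; exact: specX.
- exact: gmut_mx_Some.
Qed.

End ExtraRow.

(** * The inductive step of the Laurent phenomenon *)

Section LaurentStep.
Variables (F : fieldType) (I J : finType) (r : J -> I) (x : I -> F).
Variables (b : I -> J -> int) (j k : J).
Hypotheses (r_inj : injective r) (b_skew : skewable r b) (jk : j != k).
Hypothesis bkj : 0 <= b (r k) j.
Hypothesis nz : forall t i, (gmutseq r t (x, b)).1 i != 0.

Let c := pospart (b (r k) j).
Let x1 := gmut_x r j x b.
Let b1 := gmut_mx r j b.
Let b2 := gmut_mx r k b1.
Let z := x1 (r j).
Let Pp := \prod_i x1 i ^+ pospart (b1 i k).
Let Pm := \prod_i x1 i ^+ pospart (- b1 i k).
(** With ['X] the adjoined variable, [W] is the variable at [k] after the mutations at [j] and [k].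
    The next exchange at [j] has the monomials [W ^+ c * M1] and [M2]. *)
Let W0 := Pm / x (r k).
Let W := W0%:P + 'X * (Pp / x (r k))%:P.
Let M1 := \prod_(i | i != r k) x i ^+ pospart (b2 i j).
Let M2 := \prod_i x i ^+ pospart (- b2 i j).

Notation D := (laurent x).
Notation over := (poly_over (fun f => exists i, f = x i \/ f = (x i)^-1)).

Let rjk : r k != r j. Proof. by rewrite (inj_eq r_inj) eq_sym. Qed.

Let x_neq0 i : x i != 0. Proof. exact: (nz [::]). Qed.
Let ux i : lunit x (x i). Proof. exact: lunit_var. Qed.
Let x1E i : i != r j -> x1 i = x i.
Proof. by move=> ij; rewrite /x1 /gmut_x (negPf ij). Qed.
Let z_neq0 : z != 0. Proof. exact: (nz [:: j]). Qed.
Let zE : x (r j) * z = exchange x (b^~ j).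
Proof. by rewrite /z /x1 /gmut_x eqxx mulrC divfK. Qed.

Let bjk : b (r j) k <= 0.
Proof.
case: b_skew => d [d0 db]; have := db j k; have := d0 j; have := d0 k; move: bkj; nia.
Qed.

Let b1jk : b1 (r j) k = - b (r j) k.
Proof. by rewrite /b1 /gmut_mx eqxx. Qed.

Let b2kj : b2 (r k) j = b (r k) j.
Proof. by rewrite /b2 /gmut_mx eqxx /b1 /gmut_mx eqxx orbT opprK. Qed.

Let b2jj : b2 (r j) j = 0.
Proof. by apply: (skew_diag j); do 2!apply: gmut_mx_skewable => //. Qed.

(** As [b1 (r j) k] is nonnegative, the new variable [z] can occur only in [Pp]; this is why the
    constant term [W0] of [W] is a unit. *)
Let PmE : Pm = \prod_i x i ^+ pospart (- b1 i k).
Proof.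
apply: eq_bigr => i _; have [->|/x1E->//] := eqVneq i (r j).
by rewrite b1jk opprK; case: (b (r j) k) bjk => [[|?]|?].
Qed.

Let lunit_W0 : lunit x W0.
Proof.
rewrite /W0 PmE; apply: lunitM; last exact: lunitV.
by apply: lunit_prod => i _; exact: lunitX.
Qed.

Let lunit_M1 : lunit x M1.
Proof. by apply: lunit_prod => i _; exact: lunitX. Qed.

Let lunit_M2 : lunit x M2.
Proof. by apply: lunit_prod => i _; exact: lunitX. Qed.

Let D_z : D z.
Proof.
have -> : z = (x (r j))^-1 * exchange x (b^~ j) by rewrite -zE mulKf.
apply: gr_mul; first exact: laurent_varV.
have prod_D (g : I -> nat) : D (\prod_i x i ^+ g i).
  by have [|//] := @lunit_prod _ _ x _ (index_enum I) xpredT (fun i => x i ^+ g i);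
    move=> i _; exact: lunitX.
by rewrite /exchange; apply: gr_add; exact: prod_D.
Qed.

Let Pp_split : exists Q, D Q /\ Pp / x (r k) = z ^+ pospart (- b (r j) k) * Q.
Proof.
pose Q0 := \prod_(i | i != r j) x i ^+ pospart (b1 i k).
exists (Q0 / x (r k)); split; last first.
  rewrite mulrA /Pp (bigD1 (r j)) //= b1jk -/z; congr (_ * _ / _).
  by apply: eq_bigr => i /x1E ->.
apply: gr_mul; last exact: laurent_varV.
suff [] : lunit x Q0 by []; by apply: lunit_prod => i _; exact: lunitX.
Qed.

Let D_Pp : D (Pp / x (r k)).
Proof. by have [Q [hQ ->]] := Pp_split; apply: gr_mul => //; exact: gr_exp. Qed.

Let over_W : over W.
Proof.
apply: poly_over_add; first by apply: poly_overC; case: lunit_W0.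
by apply: poly_over_mul; [exact: poly_overX | exact: poly_overC].
Qed.

(** If [c > 0], then [b (r j) k < 0] by skew-symmetrizability, so [z] divides [Pp] and [W] is
    congruent to [W0] modulo ['X * z]; powers inherit the congruence. *)
Let W_expn : exists V, over V /\ W ^+ c = (W0 ^+ c)%:P + 'X * z%:P * V.
Proof.
have [c0|c0] := posnP c.
  exists 0; split; first by apply: poly_overC; exact: gr0.
  by rewrite c0 !expr0 mulr0 addr0.
have [Q [hQ QE]] := Pp_split.
have WE : W = W0%:P + 'X * z%:P * (z ^+ (pospart (- b (r j) k)).-1 * Q)%:P.
  rewrite /W QE -mulrA -polyCM; congr (_ + _ * _%:P).
  rewrite mulrA -exprS prednK //.
  suff : 0 < b (r k) j by rewrite (skew_gt0 _ _ b_skew); case: (b (r j) k).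
  by move: c0 bkj; rewrite /c; case: (b (r k) j) => // -[].
have hv : over (z ^+ (pospart (- b (r j) k)).-1 * Q)%:P.
  by apply: poly_overC; apply: gr_mul => //; exact: gr_exp.
move: (_%:P) hv WE => v hv WE.
elim: (c) => [|n [V [hV VE]]].
  by exists 0; split; [by apply: poly_overC; exact: gr0 | rewrite !expr0 mulr0 addr0].
exists ((W0 ^+ n)%:P * v + W * V); split.
  apply: poly_over_add; apply: poly_over_mul => //.
  by apply: poly_overC; apply: gr_exp; case: lunit_W0.
by rewrite exprS VE [in LHS]WE (exprS W0) (polyCM W0) [in RHS]WE; ring.
Qed.

(* W0 ^+ c * M1 and M2 are the two monomials of the exchange relation producing the
   variable of t3, at 'X = 0: they are in the same ratio as those of the exchange
   relation of t0 at j, and hence their sum is z times a unit. *)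
Let monomial_identity :
  W0 ^+ c * M1 * \prod_i x i ^+ pospart (b i j) = M2 * \prod_i x i ^+ pospart (- b i j).
Proof.
have GE : \prod_i x i ^+ pospart (b i j) =
    x (r k) ^+ c * \prod_(i | i != r k) x i ^+ pospart (b i j).
  by rewrite (bigD1 (r k)).
rewrite GE /W0 exprMn exprVn.
rewrite (_ : _ * _ = Pm ^+ c * (M1 * \prod_(i | i != r k) x i ^+ pospart (b i j)));
  last by field; rewrite expf_neq0.
rewrite PmE -prodrXl (bigD1 (r k)) //= /M1 /M2 -!big_split /=.
rewrite [RHS](bigD1 (r k)) //= -[LHS]mulrA -big_split /= b2kj.
have pn0 : pospart (- b (r k) j) = 0%N by case: (b (r k) j) bkj => [[|?]|?].
have b1kk : b1 (r k) k = 0 by apply: (skew_diag k); apply: gmut_mx_skewable.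
rewrite pn0 !expr0 !mul1r b1kk oppr0 !expr0 expr1n mul1r.
apply: eq_bigr => i ik; rewrite -exprM -!exprD; congr (_ ^+ _).
have [->|ij] := eqVneq i (r j).
  rewrite b2jj (skew_diag j b_skew) b1jk opprK oppr0 /=.
  by case: (b (r j) k) bjk => [[|?]|?].
(* Since [b1 (r k) j] is nonpositive, only the product of negative parts survives in the mutation at
   [k]. *)
have b2E : b2 i j = - b i j - Posz (pospart (- b1 i k) * c).
  rewrite /b2 /gmut_mx (negPf ik) (negPf jk) /=.
  have -> : b1 (r k) j = - b (r k) j by rewrite /b1 /gmut_mx eqxx orbT.
  have -> : b1 i j = - b i j by rewrite /b1 /gmut_mx eqxx orbT.
  by rewrite pn0 muln0 addr0 opprK.
move: (pospartE (b2 i j)) (pospartN (b2 i j)) (pospartE (b i j)) (pospartN (b i j)).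
rewrite b2E; move: (_ * _)%N => e.
by case: (lerP 0 (b i j)) => ?; case: (lerP 0 (- b i j - Posz e)) => ?; lia.
Qed.

Let U0 := z^-1 * (W0 ^+ c * M1 + M2).

Let lunit_U0 : lunit x U0.
Proof.
pose Gp := \prod_i x i ^+ pospart (b i j).
have uGp : lunit x Gp by apply: lunit_prod => i _; exact: lunitX.
have [Gp0 _ _] := uGp.
have -> : U0 = M2 / Gp * x (r j).
  apply: (mulfI z_neq0); apply: (mulIf Gp0); rewrite /U0 mulVKf //.
  rewrite mulrDl monomial_identity -mulrDr.
  rewrite (_ : z * _ * _ = M2 * (x (r j) * z)); last by field.
  by rewrite zE /exchange addrC.
by apply: lunitM => //; apply: lunitM => //; exact: lunitV.
Qed.

(** By [W_expn] the exchange sum agrees with its constant term modulo ['X * z], and [z] divides that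
    constant term with quotient [U0]. *)
Let U_exists : exists U, [/\ over U, U`_0 = U0 &
  z%:P * U = W ^+ c * M1%:P + M2%:P].
Proof.
have [V [hV VE]] := W_expn.
exists (U0%:P + 'X * (V * M1%:P)); split.
- apply: poly_over_add; first by apply: poly_overC; case: lunit_U0.
  apply: poly_over_mul; first exact: poly_overX.
  by apply: poly_over_mul => //; apply: poly_overC; case: lunit_M1.
- by rewrite coefD coefC mulrC coefMX addr0.
rewrite VE mulrDr -polyCM /U0 mulVKf // polyCD polyCM; ring.
Qed.

Notation F' := {fraction {poly F}}.
Notation tof := (@FracField.tofrac {poly F}).
Let emb : {rmorphism F -> F'} := tof \o polyC.

Definition adj_x : option I -> F' := fun i => if i is Some i' then tof (x i')%:P else tof 'X.
Definition adj_b : option I -> J -> int :=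
  fun i j0 => if i is Some i' then b i' j0 else Posz (j0 == k).

Let r' := Some \o r.
Let t1 := gmut r' j (adj_x, adj_b).
Let t2 := gmut r' k t1.
Let t3 := gmut r' j t2.

Let t1_Some i : t1.1 (Some i) = tof (x1 i)%:P.
Proof. by apply: (@gmut_x_Some _ _ r _ _ emb) => //; rewrite /= (negPf jk). Qed.

Let t1_b i j0 : t1.2 (Some i) j0 = b1 i j0.
Proof. exact: gmut_mx_Some. Qed.

Let t1_None j0 : t1.2 None j0 = Posz (j0 == k).
Proof.
rewrite /= /gmut_mx /=; have [->|ne] := eqVneq j0 j; first by rewrite (negPf jk).
by rewrite (negPf jk) /= !mul0n addr0 subr0.
Qed.

Let t2_b i j0 : t2.2 (Some i) j0 = b2 i j0.
Proof. by apply: gmut_mx_Some => i0 j1; exact: t1_b. Qed.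

(** The mutation at [k] adds the positive part of [b1 (r k) j = - b (r k) j] to this entry, which is
    0 by the sign assumption [bkj]. So the next exchange at [j] has no explicit factor ['X]. *)
Let t2_None : t2.2 None j = 0.
Proof.
rewrite -[t2.2]/(gmut_mx r' k t1.2); move: t1.2 t1_None t1_b => bb hN hb.
rewrite /gmut_mx /= (negPf jk) !hN eqxx (negPf jk) hb.
rewrite /b1 /gmut_mx eqxx orbT /=.
by case: (b (r k) j) bkj => [[|?]|?].
Qed.

Let tofK (p : {poly F}) : p != 0 -> tof p != 0. Proof. by rewrite tofrac_eq0. Qed.

Let t2_k : t2.1 (Some (r k)) = tof W.
Proof.
rewrite -[t2.1]/(gmut_x r' k t1.1 t1.2).
have : t1.1 None = tof 'X by [].
move: t1.1 t1.2 t1_Some t1_None t1_b => xx bb hx hN hb hX.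
rewrite /gmut_x eqxx hx x1E // exchange_option hX hN eqxx /= expr0 mul1r expr1.
have pE (g : I -> nat) : \prod_i xx (Some i) ^+ g i = tof (\prod_i x1 i ^+ g i)%:P.
  rewrite !rmorph_prod; apply: eq_bigr => i _.
  by rewrite hx !rmorphXn.
under eq_bigr do rewrite hb; under [X in _ + X]eq_bigr do rewrite hb.
rewrite !pE -/Pp -/Pm.
apply: (mulIf (tofK (p := (x (r k))%:P) _)); first by rewrite polyC_eq0.
rewrite divfK; last by rewrite tofrac_eq0 polyC_eq0.
rewrite -!tofracM -tofracD /W mulrDl -polyCM /W0 divfK // -mulrA -polyCM divfK //.
by rewrite addrC.
Qed.

Let t2_Some i : i != r k -> t2.1 (Some i) = tof (x1 i)%:P.
Proof.
move=> ik; rewrite -[t2.1]/(gmut_x r' k t1.1 t1.2).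
move: t1.1 t1_Some => xx hx; rewrite /gmut_x /= hx.
by case: eqP => // -[] /eqP; rewrite (negPf ik).
Qed.

Let t3_j U : z%:P * U = W ^+ c * M1%:P + M2%:P -> t3.1 (Some (r j)) = tof U.
Proof.
move=> UE; rewrite -[t3.1]/(gmut_x r' j t2.1 t2.2).
move: t2.1 t2.2 t2_Some t2_k t2_None t2_b => xx bb hx hk hN hb.
rewrite /gmut_x eqxx hx; last by rewrite eq_sym.
rewrite -/z; apply: (mulIf (tofK (p := z%:P) _)); first by rewrite polyC_eq0.
rewrite divfK; last by rewrite tofrac_eq0 polyC_eq0.
rewrite -tofracM [U * _]mulrC UE tofracD tofracM tofracXn exchange_option hN.
rewrite oppr0 /= !expr0 !mul1r; congr (_ + _).
  rewrite (bigD1 (r k)) //= hk hb b2kj -/c; congr (_ * _).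
  rewrite /M1 !rmorph_prod; apply: eq_bigr => i ik.
  rewrite hb; have [->|ij] := eqVneq i (r j); first by rewrite b2jj /= !expr0 !rmorph1.
  by rewrite hx // x1E // !rmorphXn.
rewrite /M2 !rmorph_prod; apply: eq_bigr => i _.
rewrite hb; have [->|ij] := eqVneq i (r j); first by rewrite b2jj oppr0 /= !expr0 !rmorph1.
have [->|ik] := eqVneq i (r k); last by rewrite hx // x1E // !rmorphXn.
rewrite b2kj; have -> : pospart (- b (r k) j) = 0%N by case: (b (r k) j) bkj => [[|?]|?].
by rewrite !expr0 !rmorph1.
Qed.

Notation lover := (lpoly_over (fun f => exists i, f = x i \/ f = (x i)^-1)).

Let lover_x i : lover (tof (x i)%:P) /\ lover (tof (x i)%:P)^-1.
Proof.
split; first by apply: lpoly_over_poly; apply: poly_overC; exact: laurent_var.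
rewrite -[tof _]/(emb (x i)) -fmorphV.
by apply: lpoly_over_poly; apply: poly_overC; exact: laurent_varV.
Qed.

Let lover_X : lover (tof 'X).
Proof. by apply: lpoly_over_poly; exact: poly_overX. Qed.

(** Seen from t1 the only denominators are powers of [z], and seen from t3 they are powers of
    [U * W], whose constant term [U0 * W0] is a unit; [lpoly_over_div] combines the two. *)
Lemma laurent_step f : laurent t1.1 f -> laurent t3.1 f -> lover f.
Proof.
move=> f1 f3.
have [U [hU UU0 UE]] := U_exists.
have W00 : W`_0 = W0 by rewrite coefD coefC mulrC coefMX addr0.
have UW0 : (U * W)`_0 = U0 * W0 by rewrite coef0M UU0 W00.
have [UWn0 _ UWV] : lunit x (U0 * W0) by apply: lunitM.
have UW_neq0 : tof U != 0 /\ tof W != 0.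
  split; rewrite tofrac_eq0; apply: contraNneq UWn0 => e0; first by rewrite -UU0 e0 coef0 mul0r.
  by rewrite -W00 e0 coef0 mulr0.
case: UW_neq0 => tU0 tW0.
have lovers g : lover g -> forall q, exists a, lover (g * q ^+ a).
  by move=> hg q; exists 0%N; rewrite expr0 mulr1.
have [a ha] : exists a, lover (f * tof z%:P ^+ a).
  apply: gen_ring_clear_denom f1; first by apply: lpoly_over_poly; exact: poly_overC.
  move=> g [[i|]]; last first.
    by case=> ->; apply: lovers => //; exact: lpoly_over_XV.
  rewrite t1_Some; have [->|ij] := eqVneq i (r j); last first.
    by rewrite x1E //; case=> ->; apply: lovers; case: (lover_x i).
  case=> ->; first by apply: lovers; apply: lpoly_over_poly; exact: poly_overC.
  exists 1%N; rewrite expr1 mulVf; first exact: lpoly_over1.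
  by rewrite tofrac_eq0 polyC_eq0.
have [a' ha'] : exists a, lover (f * tof (U * W) ^+ a).
  apply: gen_ring_clear_denom f3.
    by apply: lpoly_over_poly; exact: poly_over_mul.
  move=> g [[i|]]; last first.
    by case=> ->; apply: lovers => //; exact: lpoly_over_XV.
  have [->|ij] := eqVneq i (r j).
    rewrite (t3_j UE); case=> ->; first by apply: lovers; exact: lpoly_over_poly.
    by exists 1%N; rewrite expr1 tofracM (mulKf tU0); exact: lpoly_over_poly.
  have -> : t3.1 (Some i) = t2.1 (Some i).
    rewrite -[t3.1]/(gmut_x r' j t2.1 t2.2) /gmut_x.
    by case: eqP => // -[] /eqP; rewrite (negPf ij).
  have [->|ik] := eqVneq i (r k).
    rewrite t2_k; case=> ->; first by apply: lovers; exact: lpoly_over_poly.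
    by exists 1%N; rewrite expr1 [U * W]mulrC tofracM (mulKf tW0); exact: lpoly_over_poly.
  by rewrite t2_Some // x1E //; case=> ->; apply: lovers; case: (lover_x i).
apply: (lpoly_over_div (z := z) (q := U * W) _ _ _ _ ha ha') => //.
- exact: poly_over_mul.
- by rewrite UW0.
- by rewrite UW0.
Qed.

End LaurentStep.

(** * The Laurent phenomenon *)

Definition nonvanishing (F : fieldType) (I J : finType) (r : J -> I)
    (S : (I -> F) * (I -> J -> int)) :=
  forall t i, (gmutseq r t S).1 i != 0.

Lemma spec_neq0 (R : comNzRingType) (F E : fieldType) (alpha : {rmorphism R -> F})
    (beta : {rmorphism R -> E}) f v :
  injective alpha -> spec alpha beta f v -> v != 0 -> f != 0.
Proof.
move=> ainj fv; apply: contraNneq => f0; apply/eqP.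
by apply: (spec_inj ainj fv); rewrite f0; exact: spec0.
Qed.

Lemma gmutK (F : fieldType) (I J : finType) (r : J -> I) k
    (S : (I -> F) * (I -> J -> int)) :
  injective r -> skewable r S.2 -> nonvanishing r S -> gmut r k (gmut r k S) = S.
Proof.
case: S => x b r_inj b_skew nz; rewrite /gmut /=; congr (_, _).
  apply: gmut_xK; first exact: skew_diag b_skew.
    exact: (nz [::]).
  have := nz [:: k] (r k); rewrite /= /gmut_x eqxx mulf_eq0 negb_or.
  by case/andP.
by apply: gmut_mxK => //; exact: skew_diag b_skew.
Qed.

Lemma lpoly_over_eval1 (F : fieldType) (G : F -> Prop) f v :
  lpoly_over G f -> spec (@FracField.tofrac {poly F}) (horner_eval 1) f v ->
  gen_ring G v.
Proof.
move=> [N [p [hp fE]]] fv.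
have tinj : injective (@FracField.tofrac {poly F}).
  by move=> p1 p2 /eqP; rewrite tofrac_eq => /eqP.
have h := specM fv (spec_rmorph (@FracField.tofrac {poly F}) (horner_eval 1) ('X ^+ N)).
rewrite fE in h; have := spec_inj tinj h (spec_rmorph _ _ p).
rewrite /= /horner_eval hornerXn expr1n mulr1 => ->.
exact: poly_over_eval1.
Qed.

Theorem laurent_phenomenon (J : finType) (s : seq J) (F : fieldType) (I : finType)
    (r : J -> I) (x : I -> F) (b : I -> J -> int) :
  injective r -> skewable r b -> nonvanishing r (x, b) ->
  forall i, laurent x ((gmutseq r s (x, b)).1 i).
Proof.
have [d] := ubnP (size s).
(* The field and the row type vary in the induction, because the hypothesis is applied over the
   fractions of F[X] with rows [option I]. *)
elim: d => // d IHd in s F I r x b *.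
case: s => [|j [|k s]] sd r_inj b_skew nz i.
- exact: laurent_var.
- rewrite /= /gmut_x; case: ifP => _; last exact: laurent_var.
  apply: gr_mul; last exact: laurent_varV.
  have prod_D (g : I -> nat) : laurent x (\prod_i0 x i0 ^+ g i0).
    suff [] : lunit x (\prod_i0 x i0 ^+ g i0) by [].
    by apply: lunit_prod => i0 _; apply: lunitX; apply: lunit_var; exact: (nz [::]).
  by rewrite /exchange; apply: gr_add; exact: prod_D.
have {}sd : ((size s).+1 < d)%N by move: sd; rewrite /= ltnS.
have [jk|jk] := eqVneq j k.
  rewrite jk -[gmutseq _ _ _]/(gmutseq r s (gmut r k (gmut r k (x, b)))) gmutK //.
  by apply: IHd => //; exact: ltn_trans sd.
(* Negating the matrix swaps the two monomials of each exchange relation and leaves all variables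
   unchanged. *)
wlog bkj : b b_skew nz / 0 <= b (r k) j.
  move=> H; have [bkj|/ltW bkj] := lerP 0 (b (r k) j); first exact: H.
  have := H (fun i j => - b i j); rewrite gmutseqN /=; apply.
  - case: b_skew => e [e0 eb]; exists e; split=> // i0 j0.
    by rewrite !mulrN eb.
  - by move=> t i0; rewrite gmutseqN /=; exact: nz.
  - by rewrite oppr_ge0.
pose r' : J -> option I := Some \o r.
pose S := (adj_x x, adj_b b k).
pose alpha := @FracField.tofrac {poly F}.
pose beta : {rmorphism {poly F} -> F} := horner_eval 1.
have ainj : injective alpha by move=> p1 p2 /eqP; rewrite tofrac_eq => /eqP.
have sp t := @spec_gmutseq_option I J r _ _ _ alpha beta t (adj_x x) (adj_b b k) x b ainj.
have {}sp t : (forall i, spec alpha beta ((gmutseq r' t S).1 (Some i))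
      ((gmutseq r t (x, b)).1 i)) /\ spec alpha beta ((gmutseq r' t S).1 None) 1.
  apply: sp => //.
  - move=> i0; have := spec_rmorph alpha beta (x i0)%:P.
    by rewrite /beta /= /horner_eval hornerC.
  - by have := spec_rmorph alpha beta 'X; rewrite /beta /= /horner_eval hornerX.
have r'_inj : injective r' by move=> a1 a2 [] /r_inj.
have nz' : nonvanishing r' S.
  move=> t [i0|]; apply: (spec_neq0 ainj).
  - exact: (sp t).1.
  - exact: nz.
  - exact: (sp t).2.
  - exact: oner_neq0.
have skew' : skewable r' S.2 by case: b_skew => e [e0 eb]; exists e.
have nzt t : nonvanishing r' (gmutseq r' t S).
  by move=> t' i0; rewrite /gmutseq -foldl_cat; exact: nz'.
have skt t : skewable r' (gmutseq r' t S).2.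
  rewrite /gmutseq; elim/last_ind: t => [|t a IHt]; first exact: skew'.
  by rewrite foldl_rcons; apply: gmut_mx_skewable.
apply: lpoly_over_eval1 ((sp [:: j, k & s]).1 i).
apply: (laurent_step r_inj b_skew jk bkj nz).
  rewrite -[gmutseq _ _ _]/(gmutseq r' (k :: s) (gmut r' j S)).
  have := nzt [:: j]; have := skt [:: j]; rewrite -[gmutseq _ _ _]/(gmut r' j S).
  by case: (gmut r' j S) => y c ? ?; apply: IHd.
have T2E : gmutseq r' [:: j, k & s] S = gmutseq r' s (gmutseq r' [:: j; k] S) by [].
have T3E : gmut r' j (gmut r' k (gmut r' j S)) = gmut r' j (gmutseq r' [:: j; k] S) by [].
rewrite T2E {}T3E; have := skt [:: j; k; j]; have := nzt [:: j; k; j].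
rewrite -[gmutseq r' [:: j; k; j] S]/(gmut r' j (gmutseq r' [:: j; k] S)).
move: (gmutseq r' [:: j; k] S) (skt [:: j; k]) (nzt [:: j; k]) => T skT nzT.
(* Mutating t3 at [j] leads back to [T], so from t3 the element is reached by [j :: s], which is
   shorter than the original path. *)
have e : gmut r' j (gmut r' j T) = T by exact: gmutK.
rewrite -[X in gmutseq r' s X]e -[gmutseq _ _ _]/(gmutseq r' (j :: s) (gmut r' j T)).
by case: (gmut r' j T) => y c ? ?; apply: IHd.
Qed.

(** * Divisors of monomials in a polynomial ring *)

Section MonomialDivisors.
Variables (K : idomainType) (m : nat).
Implicit Types (p q : {mpoly K[m]}).

Lemma mnm_min_exists p : p != 0 ->
  exists2 u, u \in msupp p & forall v, v \in msupp p -> (u <= v)%O.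
Proof.
rewrite -msupp_eq0; elim: (msupp p) => // u [|v l] IHl _.
  by exists u; rewrite ?mem_head // => v; rewrite inE => /eqP ->.
have [//|w wl w_min] := IHl.
have [uw|/ltW wu] := leP u w.
  exists u; rewrite ?mem_head // => v'; rewrite inE => /predU1P[-> //|/w_min].
  exact: le_trans.
by exists w; [rewrite inE wl orbT | move=> v'; rewrite inE => /predU1P[-> //|/w_min]].
Qed.

Lemma mnm_add_inj (u v u' v' : 'X_{1..m}) :
  (u <= u')%O -> (v <= v')%O -> (u + v)%MM = (u' + v')%MM -> u = u' /\ v = v'.
Proof.
move=> uu' vv' e.
have e1 : u = u'.
  apply/eqP/negPn/negP => ne; have lt : (u < u')%O by rewrite lt_neqAle ne uu'.
  by have := ltmc_le_add lt vv'; rewrite e ltxx.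
by split=> //; move: e; rewrite e1 => /addmI.
Qed.

(** By [mnm_add_inj], [(u, v)] is the only pair of support monomials that can contribute to
    [u + v]. *)
Lemma mcoeffM_min p q u v :
  (forall w, w \in msupp p -> (u <= w)%O) -> (forall w, w \in msupp q -> (v <= w)%O) ->
  (p * q)@_(u + v) = p@_u * q@_v.
Proof.
move=> hp hq; rewrite mcoeffM.
have du : (mdeg u < (mdeg (u + v)).+1)%N by rewrite ltnS mdegD leq_addr.
have dv : (mdeg v < (mdeg (u + v)).+1)%N by rewrite ltnS mdegD leq_addl.
rewrite (bigD1 (BMultinom du, BMultinom dv)) //= big1 ?addr0 // => -[[u' du'] [v' dv']] /=.
case/andP=> /eqP e ne; apply/eqP; rewrite mulf_eq0 !mcoeff_eq0 -negb_and.
apply: contra ne => /andP[/hp uu' /hq vv'].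
have [eu ev] := mnm_add_inj uu' vv' e.
by rewrite xpair_eqE -!val_eqE /= eu ev !eqxx.
Qed.

Lemma monomial_of_le p u : (forall v, v \in msupp p -> v = u) -> p = p@_u *: 'X_[u].
Proof.
move=> h; apply/mpolyP => v; rewrite mcoeffZ mcoeffX.
have [->|ne] := eqVneq u v; first by rewrite mulr1.
rewrite mulr0; apply: memN_msupp_eq0; apply/negP => /h e.
by rewrite e eqxx in ne.
Qed.

(* The lowest and the highest monomials of a product are the products of those
   of the factors, so both factors have equal lowest and highest monomials. *)
Lemma monomial_factor p q c w : c != 0 -> p * q = c *: 'X_[w] ->
  exists a u, p = a *: 'X_[u].
Proof.
move=> c0 pq.
have pq0 : p * q != 0.
  rewrite pq; apply/negP => /eqP/(congr1 (mcoeff w)).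
  by rewrite mcoeffZ mcoeffX eqxx mulr1 mcoeff0; apply/eqP.
move: (pq0); rewrite mulf_eq0 negb_or => /andP[p0 q0].
have [u u_p u_min] := mnm_min_exists p0.
have [v v_q v_min] := mnm_min_exists q0.
have lead : mlead (p * q) = w by rewrite pq mleadZ // mleadXm.
have low : (u + v)%MM = w.
  apply/eqP; rewrite eq_sym; have := mcoeffM_min u_min v_min.
  rewrite pq mcoeffZ mcoeffX; case: eqP => // _ /esym/eqP.
  by rewrite mulr0 mulf_eq0 !mcoeff_eq0 u_p v_q.
have [] := @mnm_add_inj u v (mlead p) (mlead q).
- by apply: u_min; exact: mlead_supp.
- by apply: v_min; exact: mlead_supp.
- by rewrite low -mleadM.
move=> uE _; exists p@_u, u; apply: monomial_of_le => v' v'p.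
by apply/eqP; rewrite eq_le u_min // uE msupp_le_mlead.
Qed.

End MonomialDivisors.

Lemma spec_mmap (R : comNzRingType) (F E : fieldType) (alpha : {rmorphism R -> F})
    (beta : {rmorphism R -> E}) (K : idomainType) (m : nat)
    (kF : {rmorphism K -> F}) (kE : {rmorphism K -> E}) (x : 'I_m -> F) (v : 'I_m -> E) p :
  (forall c, spec alpha beta (kF c) (kE c)) -> (forall i, spec alpha beta (x i) (v i)) ->
  spec alpha beta (mmap kF x p) (mmap kE v p).
Proof.
move=> hc hx; rewrite /mmap; elim/big_rec2: _ => [|u w g _ gw]; first exact: spec0.
apply: specD gw; apply: specM; first exact: hc.
by apply: spec_prod => i _; exact: specX.
Qed.

(** * Algebraic independence along mutations *)

Section Independent.
Variables (K : idomainType) (F : fieldType) (kap : {rmorphism K -> F}) (m : nat).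
Variables (J : finType) (r : J -> 'I_m).
Hypothesis r_inj : injective r.
Implicit Types (x : 'I_m -> F) (b : 'I_m -> J -> int) (c : 'I_m -> int).

Definition indep x := forall p : {mpoly K[m]}, mmap kap x p = 0 -> p = 0.

Lemma indep_inj x : indep x -> injective (mmap kap x).
Proof.
by move=> hx p q e; apply/eqP; rewrite -subr_eq0; apply/eqP/hx; rewrite rmorphB /= e subrr.
Qed.

Lemma mmap_var x i : mmap kap x 'X_i = x i.
Proof. by rewrite mmapX mmap1U. Qed.

Lemma indep_neq0 x i : indep x -> x i != 0.
Proof.
move=> hx; apply/eqP => xi; have : 'X_i = 0 :> {mpoly K[m]} by apply: hx; rewrite mmap_var.
by move/(congr1 (mcoeff U_(i)%MM))/eqP; rewrite mcoeffX eqxx mcoeff0 oner_eq0.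
Qed.

Definition exchange_mpoly c : {mpoly K[m]} :=
  'X_[[multinom pospart (c i) | i < m]] + 'X_[[multinom pospart (- c i) | i < m]].

Lemma mmap_exchange x c : mmap kap x (exchange_mpoly c) = exchange x c.
Proof.
rewrite rmorphD /= !mmapX /mmap1 /exchange.
by congr (_ + _); apply: eq_bigr => i _; rewrite mnmE.
Qed.

Lemma exchange_not_monomial c i a u : c i != 0 -> exchange_mpoly c <> a *: 'X_[u].
Proof.
move=> ci e.
set u1 := [multinom pospart (c i) | i < m]; set u2 := [multinom pospart (- c i) | i < m].
have u12 : u1 != u2.
  apply/eqP => /mnmP/(_ i); rewrite !mnmE; move: ci.
  by case: (c i) => [[|n]|n].
have := congr1 (mcoeff u1) e; have := congr1 (mcoeff u2) e.
rewrite /exchange_mpoly -/u1 -/u2 !mcoeffD !mcoeffZ !mcoeffX !eqxx.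
rewrite (negPf u12) (eq_sym u2) (negPf u12) /= add0r addr0.
case: eqP => [->|_]; last by rewrite mulr0 => /eqP; rewrite oner_eq0.
by rewrite eq_sym (negPf u12) mulr0 => _ /eqP; rewrite oner_eq0.
Qed.

Lemma exchange_neq0 x c i : indep x -> c i != 0 -> exchange x c != 0.
Proof.
move=> hx ci; apply/eqP; rewrite -mmap_exchange => /hx e.
by apply: (exchange_not_monomial (a := 0) (u := 0%MM) ci); rewrite scale0r.
Qed.

(* If p vanishes at the mutated point x', then specialising x to x' and mutating
   back shows that p vanishes at x. *)
Lemma indep_gmut x b k : b (r k) k = 0 -> (exists i, b i k != 0) ->
  indep x -> indep (gmut_x r k x b).
Proof.
move=> bkk [i0 bi0] hx p.
have ex0 : exchange x (b^~ k) != 0 by exact: (exchange_neq0 hx bi0).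
set x' := gmut_x r k x b => px'.
have x'0 i : x' i != 0.
  rewrite /x' /gmut_x; case: ifP => _; last exact: indep_neq0.
  by rewrite mulf_neq0 // invr_eq0 indep_neq0.
pose alpha : {rmorphism {mpoly K[m]} -> F} := mmap kap x.
pose beta : {rmorphism {mpoly K[m]} -> F} := mmap kap x'.
have spx i : spec alpha beta (x i) (x' i).
  by have := spec_rmorph alpha beta 'X_i; rewrite /alpha /beta /= !mmap_var.
have spx' i : spec alpha beta (x' i) (x i).
  have [->|ik] := eqVneq i (r k); last first.
    have x'i : x' i = x i by rewrite /x' /gmut_x (negPf ik).
    by have := spx i; rewrite x'i.
  have -> : x (r k) = exchange x' (b^~ k) / x' (r k).
    rewrite (_ : exchange x' _ = exchange x (b^~ k)); last first.
      apply: eq_exchange => i1; rewrite /x' /gmut_x.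
      by have [->|//] := eqVneq i1 (r k); rewrite bkk eqxx.
    by rewrite /x' /gmut_x eqxx invf_div mulrC divfK.
  rewrite {1}/x' /gmut_x eqxx; apply: specM; last first.
    by apply: specV => //; exact: indep_inj.
  rewrite /exchange; apply: specD; apply: spec_prod => i1 _; exact: specX.
have sp : spec alpha beta (mmap kap x' p) (mmap kap x p).
  apply: spec_mmap => // d.
  by have := spec_rmorph alpha beta d%:MP; rewrite /alpha /beta /= !mmapC.
apply: (hx); rewrite px' in sp.
by apply: spec_inj sp (spec0 _ _); exact: (indep_inj hx).
Qed.

Definition good_seed (S : ('I_m -> F) * ('I_m -> J -> int)) :=
  [/\ indep S.1, skewable r S.2 & col_nz S.2].

Lemma good_gmut S k : good_seed S -> good_seed (gmut r k S).
Proof.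
move=> [h1 h2 h3]; split; last exact: gmut_mx_col_nz.
  by apply: indep_gmut => //; exact: skew_diag h2.
exact: gmut_mx_skewable.
Qed.

Lemma good_gmutseq S s : good_seed S -> good_seed (gmutseq r s S).
Proof. by rewrite /gmutseq; elim: s S => //= k s IHs S /(good_gmut k); exact: IHs. Qed.

Lemma good_nonvanishing S : good_seed S -> nonvanishing r S.
Proof. by move=> hS t i; apply: indep_neq0; case: (good_gmutseq t hS). Qed.

Lemma gmutseq_rev S s : good_seed S -> gmutseq r (rev s) (gmutseq r s S) = S.
Proof.
rewrite /gmutseq; elim: s S => //= k s IHs S hS.
rewrite rev_cons foldl_rcons IHs; last exact: good_gmut.
by apply: gmutK => //; [case: hS | exact: good_nonvanishing].
Qed.

(** Laurent polynomials over [K], brought to one monomial denominator; those in [laurent] have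
    integer coefficients. *)
Definition lrep x (a : F) := exists N (p : {mpoly K[m]}), a * mmap1 x N = mmap kap x p.

Lemma mmap1D x N M : mmap1 x (N + M)%MM = mmap1 x N * mmap1 x M.
Proof.
rewrite /mmap1 -big_split; apply: eq_bigr => i _.
by rewrite mnmDE exprD.
Qed.

Lemma lrep_const x (d : K) : lrep x (kap d).
Proof. by exists 0%MM, d%:MP; rewrite mmap11 mulr1 mmapC. Qed.

Lemma lrepB x a a' : lrep x a -> lrep x a' -> lrep x (a - a').
Proof.
move=> [N [p e]] [N' [p' e']]; exists (N + N')%MM, (p * 'X_[N'] - p' * 'X_[N]).
by rewrite mmap1D rmorphB !rmorphM /= -e -e' !mmapX; ring.
Qed.

Lemma lrepM x a a' : lrep x a -> lrep x a' -> lrep x (a * a').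
Proof.
move=> [N [p e]] [N' [p' e']]; exists (N + N')%MM, (p * p').
by rewrite mmap1D !rmorphM /= -e -e'; ring.
Qed.

Lemma lrep_var x i : lrep x (x i).
Proof. by exists 0%MM, 'X_i; rewrite mmap11 mulr1 mmap_var. Qed.

Lemma lrep_varV x i : x i != 0 -> lrep x (x i)^-1.
Proof.
by move=> xi; exists U_(i)%MM, 1; rewrite mmap1U mulVf // rmorph1.
Qed.

Lemma laurent_lrep x a : indep x -> laurent x a -> lrep x a.
Proof.
move=> hx; elim=> [|f [i [->|->]]|f g _ hf _ hg|f g _ hf _ hg].
- by rewrite -(rmorph1 kap); exact: lrep_const.
- exact: lrep_var.
- by apply: lrep_varV; exact: indep_neq0.
- exact: lrepB.
- exact: lrepM.
Qed.

End Independent.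

(** * Positive values at a point of a frozen coordinate hyperplane *)

Section Positive.
Variables (E : fieldType).
Hypothesis char0 : forall n, n.+1%:R != 0 :> E.

Definition posrat (v : E) := exists a d : nat, v * d.+1%:R = a.+1%:R.

Lemma posrat_neq0 v : posrat v -> v != 0.
Proof.
move=> [a [d e]]; apply/eqP => v0; have := char0 a.
by rewrite -e v0 mul0r eqxx.
Qed.

Lemma posrat1 : posrat 1.
Proof. by exists 0%N, 0%N; rewrite mul1r. Qed.

Lemma posratM v w : posrat v -> posrat w -> posrat (v * w).
Proof.
move=> [a [d e]] [a' [d' e']]; exists (a.+1 * a'.+1).-1, (d.+1 * d'.+1).-1.
by rewrite !prednK // !natrM -e -e'; ring.
Qed.

Lemma posratD v w : posrat v -> posrat w -> posrat (v + w).
Proof.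
move=> [a [d e]] [a' [d' e']].
exists (a.+1 * d'.+1 + a'.+1 * d.+1).-1, (d.+1 * d'.+1).-1.
by rewrite !prednK // natrD !natrM -e -e'; ring.
Qed.

Lemma posratV v : posrat v -> posrat v^-1.
Proof.
move=> hv; have v0 := posrat_neq0 hv; case: hv => a [d e]; exists d, a.
by rewrite -e mulKf.
Qed.

Lemma posratX v n : posrat v -> posrat (v ^+ n).
Proof.
move=> hv; elim: n => [|n IHn]; first exact: posrat1.
by rewrite exprS; exact: posratM.
Qed.

Variables (I J : finType) (r : J -> I) (j : I).
Hypothesis rj : forall k, r k != j.
Implicit Types v : I -> E.

Definition pos_off v := v j = 0 /\ forall i, i != j -> posrat (v i).

(* At most one of the two monomials of an exchange relation involves the
   coordinate j, so the other one stays positive. *)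
Lemma pos_off_exchange v c : pos_off v -> posrat (exchange v c).
Proof.
move=> [vj vpos].
have pos (g : I -> nat) : g j = 0%N -> posrat (\prod_i v i ^+ g i).
  move=> gj; elim/big_rec: _ => [|i w _ hw]; first exact: posrat1.
  apply: posratM hw; have [->|/vpos hi] := eqVneq i j; last exact: posratX.
  by rewrite gj; exact: posrat1.
have zero (g : I -> nat) : g j != 0%N -> \prod_i v i ^+ g i = 0.
  by move=> gj; rewrite (bigD1 j) //= vj expr0n (negPf gj) mul0r.
rewrite /exchange.
have [c1|c1] := eqVneq (pospart (c j)) 0%N; have [c2|c2] := eqVneq (pospart (- c j)) 0%N.
- by apply: posratD; apply: pos.
- by rewrite [X in _ + X]zero // addr0; exact: pos.
- by rewrite zero // add0r; exact: pos.
- by move: c1 c2; case: (c j) => [[|?]|?].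
Qed.

Lemma pos_off_gmut v b k : pos_off v -> pos_off (gmut_x r k v b).
Proof.
move=> hv; have [vj vpos] := hv; split; rewrite /gmut_x; first by rewrite eq_sym (negPf (rj k)).
move=> i ij; case: ifP => _; last exact: vpos.
by apply: posratM; [exact: pos_off_exchange | apply: posratV; exact: vpos].
Qed.

(** Mutations divide only by variables with index [r k != j]; their values are positive, so the
    specialization extends along the whole path. *)
Lemma spec_pos_off (R : comNzRingType) (F : fieldType) (alpha : {rmorphism R -> F})
  (beta : {rmorphism R -> E}) s x v b :
  injective alpha -> (forall i, spec alpha beta (x i) (v i)) -> pos_off v ->
  exists2 w, (forall i, spec alpha beta ((gmutseq r s (x, b)).1 i) (w i)) & pos_off w.
Proof.
move=> ainj; elim: s x v b => [|k s IHs] x v b xv hv; first by exists v.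
apply: (IHs _ (gmut_x r k v b)); last exact: pos_off_gmut.
move=> i; rewrite /gmut_x; case: eqP => // ->.
apply: specM; first by apply: specD; apply: spec_prod => i0 _; exact: specX.
by apply: specV => //; apply: posrat_neq0; case: hv => _; apply.
Qed.

End Positive.

(** The dividend is 0 when [a] and [c] have opposite signs and [2 * a * c] up to sign otherwise, so
    the division is exact. *)
Lemma half_mut_entry (a c : int) :
  ((`|a|%:Z * c + a * `|c|%:Z) %/ 2)%Z =
  Posz (pospart a * pospart c) - Posz (pospart (- a) * pospart (- c)).
Proof.
rewrite !PoszM !pospartN !pospartE.
have -> : (`|a|%:Z * c + a * `|c|%:Z) =
   ((if 0 <= a then a else 0) * (if 0 <= c then c else 0) -
   (if 0 <= a then 0 else - a) * (if 0 <= c then 0 else - c)) * 2.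
  by case: (lerP 0 a) => ?; case: (lerP 0 c) => ?; nia.
by rewrite mulzK.
Qed.

(** * From matrix seeds to seeds over arbitrary index types *)

Section Transfer.
Variables (K : idomainType) (m n : nat) (nm : (n <= m)%N).
Notation F := (ratfun K m).

Definition seed_fun (S : ('I_m -> F) * 'M[int]_(m, n)) :
    ('I_m -> F) * ('I_m -> 'I_n -> int) := (S.1, fun i j => S.2 i j).

Lemma seed_fun_mutate k S : seed_fun (mutate nm k S) = gmut (rw nm) k (seed_fun S).
Proof.
case: S => x B; rewrite /seed_fun /gmut /=; congr (_, _).
  apply: functional_extensionality => i; rewrite /mut_x /gmut_x mulrC.
  case: ifP => // _; congr (_ / _); rewrite /exchange; congr (_ + _).
    rewrite big_mkcond /=; apply: eq_bigr => j _.
    by case: (B j k) => [[|?]|?].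
  rewrite big_mkcond /=; apply: eq_bigr => j _.
  by case: (B j k) => [[|?]|?].
apply: functional_extensionality => i; apply: functional_extensionality => j.
by rewrite /mut_mx /gmut_mx mxE half_mut_entry addrA.
Qed.

Lemma seed_fun_mutseq s S : seed_fun (mutseq nm s S) = gmutseq (rw nm) s (seed_fun S).
Proof.
rewrite /mutseq /gmutseq; elim: s S => //= k s IHs S.
by rewrite IHs seed_fun_mutate.
Qed.

Lemma rw_inj : injective (rw nm).
Proof. by move=> i j /(congr1 val) /= e; apply: val_inj. Qed.

Definition kconst : {rmorphism K -> F} := @FracField.tofrac {mpoly K[m]} \o @mpolyC m K.

(** As [m > 1], connectedness gives the vertex [rw nm k] a neighbour. If the edge comes from an
    entry in row [k], skew-symmetrizability makes the transposed entry, in column [k], nonzero. *)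
Lemma seed_good x B : (1 < m)%N -> is_seed nm x B ->
  good_seed kconst (rw nm) (seed_fun (x, B)).
Proof.
move=> m1 [xind [Bcon [d [d0 dB]]]].
have skB : skewable (rw nm) (seed_fun (x, B)).2.
  by exists d; split=> // i j; have := dB i j; rewrite !mxE.
split=> // k.
have [i ik] : exists i : 'I_m, i != rw nm k.
  have [e|ne] := eqVneq (rw nm k) (Ordinal m1); last by exists (Ordinal m1); rewrite eq_sym.
  by exists (Ordinal (ltnW m1)); rewrite e.
have /connectP[[|j q]] := Bcon (rw nm k) i.
  by move=> _ e; rewrite e eqxx in ik.
rewrite /= => /andP[/orP[|] /existsP[l /andP[/eqP lE Bl]] _] _.
  exists j; rewrite /= -lE; apply: contraNneq Bl => Bk.
  case: skB => e [e0 eB]; have := eB k l; have := e0 k; have := e0 l.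
  by rewrite /= Bk; nia.
by exists j; rewrite /= -(rw_inj lE).
Qed.

End Transfer.

(** * The cluster algebra and the irreducibility of its cluster variables *)

Section ClusterAlgebra.
Variables (K : idomainType) (m n p : nat) (nm : (n <= m)%N).
Hypotheses (np : (n <= p)%N) (char0 : forall q, q.+1%:R != 0 :> K).
Notation F := (ratfun K m).
Variables (x : 'I_m -> F) (B : 'M[int]_(m, n)).
Notation r := (rw nm).
Notation kap := (kconst K m).
Notation S0 := (seed_fun (x, B)).
Notation A := (in_cluster_alg p nm x B).
Hypothesis good0 : good_seed kap r S0.

Lemma rw_neq (j : 'I_m) k : (n <= j)%N -> r k != j.
Proof. by move=> nj; apply/eqP => e; move: nj; rewrite -e /= leqNgt ltn_ord. Qed.

Lemma gmutseq_frozen s (j : 'I_m) : (n <= j)%N -> (gmutseq r s S0).1 j = x j.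
Proof.
move=> nj; rewrite -[RHS]/(S0.1 j) /gmutseq; elim: s (S0) => //= k s IHs S.
by rewrite IHs /= /gmut_x eq_sym (negPf (rw_neq k nj)).
Qed.

Lemma cluster_var_gmutseq t i : A ((gmutseq r t S0).1 (r i)).
Proof.
apply: ga_gen; right; right; exists t, i.
by rewrite -seed_fun_mutseq.
Qed.

Lemma alg_prod (I : Type) (l : seq I) (P : pred I) (f : I -> F) :
  (forall i, P i -> A (f i)) -> A (\prod_(i <- l | P i) f i).
Proof.
move=> hf; elim/big_rec: _ => [|i a Pi ha]; last by apply: ga_mul => //; exact: hf.
by rewrite -(rmorph1 kap); exact: ga_const.
Qed.

Lemma alg_exp a e : A a -> A (a ^+ e).
Proof.
move=> ha; elim: e => [|e IHe]; last by rewrite exprS; exact: ga_mul.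
by rewrite expr0 -(rmorph1 kap); exact: ga_const.
Qed.

(** * Exponents of elements of the algebra relative to a reached seed *)

Section Seed.
Variable s : seq 'I_n.
Notation S := (gmutseq r s S0).
Notation y := (S.1).

Let goodS : good_seed kap r S.
Proof. by apply: good_gmutseq => //; exact: rw_inj. Qed.

Let y_indep : indep kap y. Proof. by case: goodS. Qed.
Let y_neq0 i : y i != 0. Proof. exact: indep_neq0 y_indep. Qed.

Lemma alg_var i : A (y i).
Proof.
have [ni|ni] := leqP n i; last first.
  by rewrite (_ : i = r (Ordinal ni)); [exact: cluster_var_gmutseq | exact: val_inj].
rewrite gmutseq_frozen //; apply: ga_gen; have [pi|ip] := leqP p i.
  by right; left; exists i.
by left; exists i; split=> //; left.
Qed.

Lemma alg_varV (i : 'I_m) : (n <= i)%N -> (i < p)%N -> A (y i)^-1.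
Proof.
move=> ni ip; rewrite gmutseq_frozen //; apply: ga_gen.
by left; exists i; split=> //; right.
Qed.

Lemma gmutseq_reach t : gmutseq r t S0 = gmutseq r (rev s ++ t) S.
Proof.
rewrite {2}/gmutseq foldl_cat -/(gmutseq r (rev s) S) (gmutseq_rev _ _ good0) //.
exact: rw_inj.
Qed.

(** Going back along [rev s], every cluster variable is reached from [S], so the Laurent phenomenon
    applies with [S] as initial seed. *)
Lemma alg_lrep a : A a -> lrep kap y a.
Proof.
have neg b : lrep kap y b -> lrep kap y (- b).
  move=> hb; rewrite -sub0r; apply: lrepB => //.
  by rewrite -(rmorph0 kap); exact: lrep_const.
elim=> [c|z|b b' _ hb _ hb'|b _ hb|b b' _ hb _ hb'].
- exact: lrep_const.
- case=> [[j [nj jp]]|[[j [pj ->]]|[t [i ->]]]].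
  + rewrite -(gmutseq_frozen s nj); case=> ->; first exact: lrep_var.
    by apply: lrep_varV; exact: y_neq0.
  + by rewrite -(gmutseq_frozen s (leq_trans np pj)); exact: lrep_var.
  + rewrite -[(mutseq _ _ _).1]/(seed_fun (mutseq nm t (x, B))).1 seed_fun_mutseq
        (gmutseq_reach t).
    apply: laurent_lrep => //; have [_ skS _] := goodS.
    have nzS : nonvanishing r S by apply: good_nonvanishing goodS; exact: rw_inj.
    rewrite [S]surjective_pairing in nzS.
    have := laurent_phenomenon (rev s ++ t) (@rw_inj m n nm) skS nzS (r i).
    by rewrite -surjective_pairing.
- by rewrite -[b']opprK; apply: lrepB => //; exact: neg.
- exact: neg.
- exact: lrepM.
Qed.

(** If [M j < N j], clearing every denominator of [a] except one factor [y j] yields an element of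
    the algebra that is a monomial free of [y j] divided by [y j]. *)
Lemma exponent_bound a c (N M : 'X_{1..m}) j :
  A a -> a * mmap1 y N = kap c * mmap1 y M ->
  (forall a' (R : 'X_{1..m}), A a' -> R j = 0%N -> a' * y j = kap c * mmap1 y R -> False) ->
  (N j <= M j)%N.
Proof.
move=> ha e no; rewrite leqNgt; apply/negP => MN.
(* The exponent of [y j] is one less than [N j - M j], so exactly one [y j] stays in the
   denominator. *)
pose a' := a * (y j ^+ (N j - (M j).+1) * \prod_(i < m | i != j) y i ^+ N i).
pose R := [multinom (if i == j then 0%N else M i) | i < m].
apply: (no a' R).
- apply: ga_mul => //; apply: ga_mul; first by apply: alg_exp; exact: alg_var.
  by apply: alg_prod => i _; apply: alg_exp; exact: alg_var.
- by rewrite mnmE eqxx.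
have yM : y j ^+ M j != 0 by rewrite expf_neq0.
apply: (mulIf yM).
have RE : mmap1 y R * y j ^+ M j = mmap1 y M.
  rewrite /mmap1 (bigD1 j) //= [RHS](bigD1 j) //= mnmE eqxx expr0 mul1r mulrC; congr (_ * _).
  by apply: eq_bigr => i ij; rewrite mnmE (negPf ij).
rewrite -[RHS]mulrA RE -e /mmap1 (bigD1 j) //= /a'.
have -> : y j ^+ N j = y j ^+ (N j - (M j).+1) * y j * y j ^+ M j.
  by rewrite -exprSr -exprD; congr (_ ^+ _); lia.
ring.
Qed.

(* In the seed mutated at k the element y_k becomes the exchange binomial over a
   variable, and a binomial does not divide a monomial. *)
Lemma var_dvd_mutable k c a (R : 'X_{1..m}) :
  (forall b, A b -> lrep kap (gmut r k S).1 b) ->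
  c != 0 -> A a -> R (r k) = 0%N -> a * y (r k) = kap c * mmap1 y R -> False.
Proof.
move=> lrep' c0 ha Rk e.
have [_ skS colS] := goodS.
set y' := (gmut r k S).1 in lrep'.
have y'_indep : indep kap y' by case: (good_gmut (@rw_inj m n nm) k goodS).
have bkk : S.2 (r k) k = 0 by exact: skew_diag skS.
have y'E i : i != r k -> y' i = y i by move=> ik; rewrite /y' /= /gmut_x (negPf ik).
pose P := exchange_mpoly K (fun i => S.2 i k).
have PE : mmap kap y' P = y (r k) * y' (r k).
  rewrite mmap_exchange (_ : exchange y' _ = exchange y (fun i => S.2 i k)); last first.
    by apply: eq_exchange => i; have [->|/y'E] := eqVneq i (r k); rewrite ?bkk ?eqxx.
  by rewrite /y' /= /gmut_x eqxx mulrC divfK.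
have [N [q qE]] := lrep' a ha.
have RE : mmap1 y R = mmap1 y' R.
  by apply: eq_bigr => i _; have [->|/y'E->//] := eqVneq i (r k); rewrite Rk.
have PqE : P * q = c *: 'X_[(R + U_(r k) + N)%MM].
  apply: (indep_inj y'_indep); rewrite rmorphM /= mmapZ mmapX !mmap1D mmap1U PE -qE.
  rewrite mulrA !(mulrA (kap c)) -RE -e; ring.
have [d [u dE]] := monomial_factor c0 PqE.
by have [i bi] := colS k; exact: (exchange_not_monomial (c := fun i => S.2 i k) bi dE).
Qed.

(** At the point [v], where [y j] is 0 and the other variables are 1, [a] has a value; hence the
    left side becomes 0 and the right side becomes [c]. *)
Lemma var_dvd_frozen (j : 'I_m) c a (R : 'X_{1..m}) :
  (p <= j)%N -> c != 0 -> A a -> R j = 0%N -> a * y j = kap c * mmap1 y R -> False.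
Proof.
move=> pj c0 ha Rj e.
pose E := {fraction K}.
pose kE : {rmorphism K -> E} := @FracField.tofrac K.
pose v : 'I_m -> E := fun i => (i != j)%:R.
pose alpha : {rmorphism {mpoly K[m]} -> F} := mmap kap y.
pose beta : {rmorphism {mpoly K[m]} -> E} := mmap kE v.
have ainj : injective alpha by exact: indep_inj y_indep.
have charE q : q.+1%:R != 0 :> E.
  by rewrite -(rmorph_nat kE) /= tofrac_eq0.
have nj := leq_trans np pj.
have vpos : pos_off j v.
  split=> [|i ij]; first by rewrite /v eqxx.
  by rewrite /v ij; exact: posrat1.
have spy i : spec alpha beta (y i) (v i).
  by have := spec_rmorph alpha beta 'X_i; rewrite /alpha /beta /= !mmap_var.
have spk d : spec alpha beta (kap d) (kE d).
  by have := spec_rmorph alpha beta d%:MP; rewrite /alpha /beta /= !mmapC.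
have [w aw] : exists w, spec alpha beta a w.
  elim: ha => [d|z|b b' _ [w hb] _ [w' hb']|b _ [w hb]|b b' _ [w hb] _ [w' hb']].
  - by exists (kE d); exact: spk.
  - case=> [[i [ni ip]]|[[i [pi ->]]|[t [i ->]]]].
    + rewrite -(gmutseq_frozen s ni); case=> ->; first by exists (v i).
      (* An inverted frozen variable has index below [p], hence different from [j]. *)
      exists (v i)^-1; apply: specV => //; apply: (posrat_neq0 charE).
      case: vpos => _; apply; apply: contraTneq ip => ->.
      by rewrite -leqNgt.
    + by rewrite -(gmutseq_frozen s (leq_trans np pi)); exists (v i).
    + rewrite -[(mutseq _ _ _).1]/(seed_fun (mutseq nm t (x, B))).1 seed_fun_mutseq
        (gmutseq_reach t).
      have [w hw _] := @spec_pos_off E charE _ _ r j (fun k => rw_neq k nj) _ _ alpha beta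
        (rev s ++ t) y v S.2 ainj spy vpos.
      by exists (w (r i)); have := hw (r i); rewrite -surjective_pairing.
  - by exists (w + w'); exact: specD.
  - by exists (- w); exact: specN.
  - by exists (w * w'); exact: specM.
have h1 := specM aw (spy j).
have h2 : spec alpha beta (kap c * mmap1 y R) (kE c * \prod_i v i ^+ R i).
  by apply: specM => //; apply: spec_prod => i _; exact: specX.
rewrite e in h1; have := spec_inj ainj h1 h2.
rewrite {1}/v eqxx mulr0 big1 => [/esym/eqP|i _]; last first.
  by rewrite /v; have [->|_] := eqVneq i j; rewrite ?Rj // expr1n.
by rewrite mulr1 /= tofrac_eq0 (negPf c0).
Qed.

(** The inverse monomial has nonzero exponents only at invertible frozen variables, so it lies in
    the algebra. *)
Lemma monomial_unit a c c' (N M : 'X_{1..m}) :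
  A a -> a * mmap1 y N = kap c * mmap1 y M -> c * c' = 1 ->
  (forall j : 'I_m, ~~ ((n <= j) && (j < p))%N -> N j = M j) -> unit_in A a.
Proof.
move=> ha e cc NM; split=> //.
pose b := kap c' * \prod_(i < m) (y i ^+ N i / y i ^+ M i); exists b; split.
  apply: ga_mul; first exact: ga_const.
  apply: alg_prod => i _; have [/andP[ni ip]|/NM->] := boolP ((n <= i) && (i < p))%N.
    rewrite -exprVn; apply: ga_mul; apply: alg_exp; first exact: alg_var.
    exact: alg_varV.
  rewrite divff ?expf_neq0 //.
  by rewrite -(rmorph1 kap); exact: ga_const.
have M0 : mmap1 y M != 0 by apply/prodf_neq0 => i _; rewrite expf_neq0.
rewrite /b big_split /= prodfV.
rewrite -[\prod_(i < m) y i ^+ N i]/(mmap1 y N) -[\prod_(i < m) y i ^+ M i]/(mmap1 y M).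
rewrite (_ : _ * _ = a * mmap1 y N * (kap c' / mmap1 y M)); last by ring.
by rewrite e mulrACA divff // mulr1 -rmorphM cc rmorph1.
Qed.

End Seed.

Lemma cluster_var_irreducible s k : irreducible_in A ((gmutseq r s S0).1 (r k)).
Proof.
set y := (gmutseq r s S0).1.
have rI := @rw_inj m n nm.
have y_indep : indep kap y by case: (good_gmutseq rI s good0).
have bound a c N M (j : 'I_m) : c != 0 -> A a -> a * mmap1 y N = kap c * mmap1 y M ->
    ~~ ((n <= j) && (j < p))%N -> (N j <= M j)%N.
  move=> c0 ha e jnp; apply: (exponent_bound ha e) => a' R ha' Rj e'.
  have [nj|jn] := leqP n j.
    by apply: (var_dvd_frozen _ c0 ha' Rj e'); move: jnp; rewrite nj -leqNgt.
  have jE : j = r (Ordinal jn) by exact: val_inj.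
  rewrite jE in Rj e'; apply: (var_dvd_mutable _ c0 ha' Rj e') => b hb.
  have := alg_lrep (s ++ [:: Ordinal jn]) hb.
  by rewrite {1}/gmutseq foldl_cat.
have knp : ~~ ((n <= r k) && (r k < p))%N by rewrite /= leqNgt ltn_ord.
split; first exact: cluster_var_gmutseq.
  (* An inverse of the cluster variable would have exponent -1 at [r k], against [bound]. *)
  move=> [_ [b [hb e]]].
  have := @bound b 1 U_(r k)%MM 0%MM (r k) (oner_neq0 _) hb.
  rewrite mmap1U mmap11 rmorph1 mulr1 mulrC e mnm1E eqxx mnm0E => H.
  by have := H erefl knp.
move=> a b ha hb e.
have [N1 [p1 e1]] := alg_lrep s ha; have [N2 [p2 e2]] := alg_lrep s hb.
pose w := (U_(r k) + N1 + N2)%MM.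
have p12 : p1 * p2 = 1 *: 'X_[w].
  apply: (indep_inj y_indep); rewrite rmorphM /= -e1 -e2 mmapZ rmorph1 mul1r mmapX.
  by rewrite !mmap1D mmap1U -/y e; ring.
have [c1 [M1 p1E]] := monomial_factor (oner_neq0 _) p12.
have p21 : p2 * p1 = 1 *: 'X_[w] by rewrite mulrC.
have [c2 [M2 p2E]] := monomial_factor (oner_neq0 _) p21.
have := p12; rewrite p1E p2E -scalerAl -scalerAr scalerA -mpolyXD => cX.
have MW : (M1 + M2)%MM = w.
  apply/eqP; have := congr1 (mcoeff w) cX; rewrite !mcoeffZ !mcoeffX eqxx.
  by case: eqP => // _; rewrite mulr0 mulr1 => /esym/eqP; rewrite oner_eq0.
have cc : c1 * c2 = 1.
  by have := congr1 (mcoeff w) cX; rewrite !mcoeffZ !mcoeffX MW eqxx !mulr1.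
have c1n0 : c1 != 0 by apply: contra_eq_neq cc => ->; rewrite mul0r eq_sym oner_neq0.
have c2n0 : c2 != 0 by apply: contra_eq_neq cc => ->; rewrite mulr0 eq_sym oner_neq0.
rewrite p1E mmapZ mmapX in e1; rewrite p2E mmapZ mmapX in e2.
have sumE j : (M1 j + M2 j = (r k == j) + N1 j + N2 j)%N.
  by rewrite -mnmDE MW !mnmDE mnm1E.
have b1 j := @bound a c1 N1 M1 j c1n0 ha e1.
have b2 j := @bound b c2 N2 M2 j c2n0 hb e2.
(* Away from the invertible frozen indices the exponents [M1 - N1] of [a] and [M2 - N2] of [b] are
   nonnegative with sum [r k == j]. The factor with exponent 0 at [r k] thus has exponent 0 at all
   these indices and is a unit. *)
have [Mk|Mk] := eqVneq (M1 (r k)) (N1 (r k)).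
  left; apply: (monomial_unit ha e1 cc) => j jnp.
  have := sumE j; have := b1 j jnp; have := b2 j jnp.
  by have [<-|ne] := eqVneq (r k) j; lia.
right; apply: (monomial_unit (c' := c1) hb e2) => [|j jnp]; first by rewrite mulrC.
have := sumE j; have := b1 j jnp; have := b2 j jnp.
have [<-|ne] := eqVneq (r k) j; last by lia.
by move: Mk => /eqP; lia.
Qed.

End ClusterAlgebra.

Theorem theorem3p1 (K : idomainType)
  (hK : ((forall c : K, c != 0 -> c \is a GRing.unit) /\ [pchar K] =i pred0)
        \/ exists f : {rmorphism int -> K}, bijective f)
  (m p n : nat) (hm : (1 < m)%N) (hmp : (p <= m)%N) (hpn : (n <= p)%N)
  (hn : (1 <= n)%N) (nm : (n <= m)%N)
  (x : 'I_m -> ratfun K m) (B : 'M[int]_(m, n)) :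
  is_seed nm x B ->
  forall z : ratfun K m, cluster_variable nm x B z ->
    irreducible_in (in_cluster_alg p nm x B) z.
Proof.
move=> hS z [s [k ->]].
have char0 q : q.+1%:R != 0 :> K.
  apply/negP; case: hK => [[_ ch]|[f [g fK _]]] e.
    by have [l] := natf0_pchar (ltn0Sn q) e; rewrite ch.
  move: e; rewrite -(rmorph_nat f) -(rmorph0 f) (can_eq fK).
  by rewrite pnatr_eq0.
rewrite -[(mutseq _ _ _).1]/(seed_fun (mutseq nm s (x, B))).1 seed_fun_mutseq.
exact: cluster_var_irreducible (seed_good hm hS) s k.
Qed.
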